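(* Let $\theta\in(0,1)$ be an irrational number such that $\theta^2=1/m$ for some positive integer $m$ that is not a perfect square. For any real $\alpha\ge 0$, the set \[ E_\theta(\alpha)=\left\{x\in[0,\theta]\setminus\mathbb{Q} : \lim_{n\to+\infty}\frac{L_{n,\theta}(x)\,\log n\,\log\log n}{S_{n,\theta}(x)-L_{n,\theta}(x)}=\alpha\right\} \] satisfies $\dim_H E_\theta(\alpha)=1$, where $\dim_H$ denotes Hausdorff dimension.
   Context: The generalized Gauss map $T_\theta:[0,\theta]\to[0,\theta]$ is defined by $T_\theta(x)=\frac1x-\theta\left\lfloor\frac{1}{\theta x}\right\rfloor$ for $x\in(0,\theta]$ and $T_\theta(0)=0$. For $n\ge1$ the $n$-th digit of $x\in[0,\theta]$ is $\ell_n(x)=\left\lfloor\frac{1}{\theta\,T_\theta^{n-1}(x)}\right\rfloor$, where $T_\theta^0(x)=x$, with the convention $\ell_n(x)=+\infty$ if $T_\theta^{n-1}(x)=0$. The digits satisfy $\ell_n(x)\ge m$, and $x$ has the $\theta$-expansion $x=[\ell_1(x),\ell_2(x),\ldots]_\theta=\cfrac{1}{\theta\ell_1(x)+\cfrac{1}{\theta\ell_2(x)+\ddots}}$. Define $S_{n,\theta}(x)=\sum_{k=1}^n\ell_k(x)$ and $L_{n,\theta}(x)=\max_{1\le k\le n}\ell_k(x)$. Points $x$ having some digit equal to $+\infty$ (those whose $T_\theta$-orbit hits $0$; a countable set) are not counted as members of $E_\theta(\alpha)$. The ratio is considered for $n$ large (say $n\ge3$). *)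

(* Defs.v *)
From mathcomp Require Import all_boot all_order all_algebra.
From mathcomp Require Import all_classical all_reals all_analysis.
Import Order.TTheory GRing.Theory Num.Theory numFieldNormedType.Exports.

Set Implicit Arguments.
Unset Strict Implicit.
Unset Printing Implicit Defensive.

Local Open Scope classical_set_scope.
Local Open Scope ring_scope.

Section Hausdorff.
Context {R : realType}.
Implicit Types (A U : set R) (s delta : R).
Local Open Scope ereal_scope.

(* The maximum with 0 only matters for the empty set, whose supremum of
   distances would otherwise be -oo. *)
Definition diam U : \bar R :=
  maxe 0 (ereal_sup [set `|p.1 - p.2|%:E | p in U `*` U]).

Definition is_cover delta A (U : nat -> set R) : Prop :=
  A `<=` \bigcup_i U i /\ forall i, diam (U i) <= delta%:E.

(* Empty sets of a cover contribute nothing, also when s = 0 (where poweR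
   gives 0 `^ 0 = 1), so countable families account for finite covers. *)
Definition hausdorff_content delta s A : \bar R :=
  ereal_inf [set \sum_(0 <= i <oo | U i != set0) poweR (diam (U i)) s
            | U in is_cover delta A].

Definition hausdorff_measure s A : \bar R :=
  ereal_sup [set hausdorff_content delta s A
            | delta in [set delta | (0 < delta)%R]].

Definition hausdorff_dim A : \bar R :=
  ereal_inf [set s%:E | s in [set s | (0 <= s)%R /\ hausdorff_measure s A = 0]].

End Hausdorff.

Section ThetaExpansion.
Context {R : realType}.
Implicit Types (theta x alpha : R) (n k : nat).

(* Total on R; meaningful on [0, theta], which it maps into itself. *)
Definition gauss_map theta x : R :=
  if x == 0 then 0
  else x^-1 - theta * (Num.floor (1 / (theta * x)))%:~R.

(* Digits are numbered from 1. *)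
Definition digit theta n x : \bar R :=
  let y := iter n.-1 (gauss_map theta) x in
  if y == 0 then +oo%E else (Num.floor (1 / (theta * y)))%:~R%:E.

Definition digit_sum theta n x : \bar R :=
  (\sum_(1 <= k < n.+1) digit theta k x)%E.

Definition digit_max theta n x : \bar R :=
  \big[maxe/-oo%E]_(1 <= k < n.+1) digit theta k x.

(* [fine] loses nothing here: E_set below only contains points all of whose
   digits are finite. *)
Definition trimmed_ratio theta x n : R :=
  let L := fine (digit_max theta n x) in
  let S := fine (digit_sum theta n x) in
  L * ln n%:R * ln (ln n%:R) / (S - L).

Definition E_set theta alpha : set R :=
  [set x | [/\ 0 <= x <= theta, irrational x,
               forall n, (0 < n)%N -> (digit theta n x < +oo)%E
             & trimmed_ratio theta x n @[n --> \oo] --> alpha]].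

End ThetaExpansion.

(* Main.v *)
Require Import Defs.
From mathcomp Require Import all_boot all_order all_algebra.
From mathcomp Require Import all_classical all_reals all_analysis.
From mathcomp Require Import zify ring lra.
Import Order.TTheory GRing.Theory Num.Theory numFieldNormedType.Exports.
Set Implicit Arguments.
Unset Strict Implicit.
Unset Printing Implicit Defensive.
Local Open Scope classical_set_scope.
Local Open Scope ring_scope.

(** The upper bound holds because [E_set theta alpha] lies in the unit
    interval.  For the lower bound fix [s < 1].

    Points all of whose digits lie between [m] and a large [M] form a set of
    dimension close to 1, but their ratios tend to 0.  To make the ratio tend
    to [alpha], only the digits at the positions [k ^ 3], [k] large, are
    imposed: such a digit is computed from the preceding ones, as about
    [alpha * S / (ln n * ln (ln n))] where [n = k ^ 3] and [S] is the sum of all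
    earlier digits.  Since [ln n * ln (ln n)] increases slowly along the cubes,
    these digits increase, so the last one is the maximum [L] until the next
    cube; meanwhile the free digits add only [O(k ^ 2)] to the other digits,
    whose sum is at least [k ^ 3 - 1].  Hence the ratio tends to [alpha]
    whatever the free digits are ([follows_ratio_cvg]).

    The set of these points is large because [ [0, 1[ ] is coded by it: the
    free digits of the point coded by [t] are drawn, along [t], with
    probabilities proportional to the lengths of the admissible subcylinders.
    Reals whose codes share [n] digits are at distance at most the product of the
    probabilities of these digits.  A free subcylinder has relative length
    [r <= 1/2], so its probability is at most [r ^ s / K] for some [K > 1] once
    [M] is large: compared with the [s]-th power of the length of the cylinder,
    each free digit gains a factor [K], and an imposed digit [d] loses at most
    [(d + 1) ^ 2] ([coding_dist]).  Among [n] digits about [n ^ (1/3)] are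
    imposed, each of them [exp (O (n ^ (1/3)))], so the total loss is
    [exp (O (n ^ (2/3)))], much less than the gain ([follows_weight_sum]).
    The distance of points whose expansions differ after [n] common digits is
    at least the length of the common cylinder, up to a factor linear in the
    digits that follow, which is absorbed likewise ([tail_dist_ge]).  Therefore [|t - u| <= C |x_t - x_u| ^ s]
    ([point_hoelder]), and countable subadditivity of Lebesgue measure on
    [ [0, 1[ ] bounds every cover of [E_set theta alpha] from below
    ([hausdorff_measure_neq0]); the [t] coding rational points are countable,
    because coding is injective. *)

(** * Lengths of cylinders *)

Section Cylinders.
Variables (R : realType) (m : nat).
Hypothesis m_gt1 : (1 < m)%N.
Implicit Types (a b : nat -> nat).

Let m_ge2 : 2 <= m%:R :> R. Proof. by rewrite ler_nat. Qed.

(** With [q_n] the denominators of the convergents of the expansion with digits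
    [a], this is [q_(n-1) / (theta * q_n)]; the factor [1 / theta] makes the
    recursion free of [theta]. *)
Fixpoint offset a n : R :=
  if n is n'.+1 then m%:R / ((a n')%:R + offset a n') else 0.

(** The length of the cylinder of the first [n] digits divided by the length
    [theta] of the whole interval. *)
Fixpoint cyl_length a n : R :=
  if n is n'.+1 then cyl_length a n' *
    ((m%:R + offset a n') / (((a n')%:R + offset a n') * ((a n')%:R + 1 + offset a n')))
  else 1.

Lemma offset_bounds a n : (forall i, (i < n)%N -> (m <= a i)%N) ->
  0 <= offset a n <= 1.
Proof.
have m2 := m_ge2.
elim: n => [|n IH] ma /=; first by rewrite lexx ler01.
have /andP[IH0 IH1] := IH (fun i ni => ma i (ltnW ni)).
have am : m%:R <= (a n)%:R :> R by rewrite ler_nat ma.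
rewrite divr_ge0 ?ler_pdivrMr//=; lra.
Qed.

Lemma cyl_length_gt0 a n : (forall i, (m <= a i)%N) -> 0 < cyl_length a n.
Proof.
have m2 := m_ge2.
move=> ma; elim: n => [|n IH] //=.
have am : m%:R <= (a n)%:R :> R by rewrite ler_nat.
have /andP[t0 t1] := offset_bounds (fun i (_ : (i < n)%N) => ma i).
rewrite mulr_gt0// divr_gt0// ?mulr_gt0//; lra.
Qed.

Lemma cyl_length_le1 a n : (forall i, (m <= a i)%N) -> cyl_length a n <= 1.
Proof.
have m2 := m_ge2; move=> ma; elim: n => [|n IH] //=.
have am : m%:R <= (a n)%:R :> R by rewrite ler_nat.
have /andP[t0 t1] := offset_bounds (fun i (_ : (i < n)%N) => ma i).
apply: mulr_ile1 => //; first exact: ltW (cyl_length_gt0 n ma).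
  by rewrite divr_ge0 ?mulr_ge0//; lra.
rewrite ler_pdivrMr ?mul1r ?mulr_gt0//; [|lra|lra].
have : 0 <= ((a n)%:R + offset a n) * ((a n)%:R + offset a n).
  by rewrite mulr_ge0//; lra.
lra.
Qed.

Lemma eq_offset a b n : (forall i, (i < n)%N -> a i = b i) -> offset a n = offset b n.
Proof.
elim: n => //= n IH h; rewrite IH ?h// => i ni; apply: h; exact: ltnW.
Qed.

Lemma eq_cyl_length a b n : (forall i, (i < n)%N -> a i = b i) ->
  cyl_length a n = cyl_length b n.
Proof.
elim: n => //= n IH h.
rewrite IH ?h// ?(eq_offset (b := b))// => i ni; apply: h; exact: ltnW.
Qed.

End Cylinders.

(** * Theta-expansions with prescribed digits *)

Section Tail.
Variables (R : realType) (theta : R) (m : nat).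
Hypotheses (theta_gt0 : 0 < theta) (m_gt1 : (1 < m)%N)
  (theta_sq : theta ^+ 2 * m%:R = 1).
Implicit Types (a b : nat -> nat).

Let m_ge2 : 2 <= m%:R :> R. Proof. by rewrite ler_nat. Qed.

Lemma theta_lt1 : theta < 1.
Proof.
rewrite ltNge; apply/negP => t1.
have: 1 <= theta ^+ 2 by rewrite exprn_ege1.
have := theta_sq; have := m_ge2; set y := theta ^+ 2; set z := m%:R; nra.
Qed.

Let theta_m : theta * m%:R = theta^-1.
Proof.
apply: (mulfI (lt0r_neq0 theta_gt0)).
by rewrite mulrA -expr2 theta_sq divff// gt_eqF.
Qed.

Fixpoint approximant a n k : R :=
  if n is n'.+1 then (theta * (a k)%:R + approximant a n' k.+1)^-1 else 0.

(** The number with expansion [a k, a k.+1, ...]. *)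
Definition tail a k : R := lim (approximant a n k @[n --> \oo]).

Lemma denominator_ge a k (u : R) : (forall i, (m <= a i)%N) -> 0 <= u ->
  theta^-1 + u <= theta * (a k)%:R + u.
Proof. by move=> ma u0; rewrite lerD2r -theta_m ler_pM2l// ler_nat. Qed.

Let theta_inv_gt0 : 0 < theta^-1. Proof. by rewrite invr_gt0. Qed.

Lemma approximant_bounds a n k : (forall i, (m <= a i)%N) ->
  0 <= approximant a n k <= theta.
Proof.
have ti := theta_inv_gt0; have m2 := m_ge2.
move=> ma; elim: n k => [|n IH] k /=; first by rewrite lexx ltW.
have /andP[h0 h1] := IH k.+1.
have h := denominator_ge k ma h0.
rewrite invr_ge0; apply/andP; split; first by lra.
rewrite -[leRHS]invrK lef_pV2 ?posrE//; lra.
Qed.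

(** The inverse branches of the Gauss map contract by [theta ^+ 2 = 1 / m], and
    [m] is at least 2. *)
Lemma inv_contraction (c u v : R) : theta^-1 <= c -> 0 <= u -> 0 <= v ->
  `|(c + u)^-1 - (c + v)^-1| <= 2^-1 * `|u - v|.
Proof.
have ti := theta_inv_gt0; have m2 := m_ge2.
move=> hc u0 v0.
have c0 : 0 < c by lra.
have -> : (c + u)^-1 - (c + v)^-1 = (v - u) * ((c + u) * (c + v))^-1.
  by field; lra.
rewrite normrM distrC mulrC ler_wpM2r// ger0_norm; last first.
  by rewrite invr_ge0 mulr_ge0//; lra.
rewrite lef_pV2 ?posrE//; last by rewrite mulr_gt0//; lra.
have ti2 : (theta^-1) ^+ 2 = m%:R.
  by rewrite -theta_m exprMn [m%:R ^+ 2]expr2 mulrA theta_sq mul1r.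
apply: le_trans m2 _; rewrite -ti2 expr2 ler_pM//; lra.
Qed.

Lemma approximant_step a n k : (forall i, (m <= a i)%N) ->
  `|approximant a n.+1 k - approximant a n k| <= 2^-1 ^+ n.
Proof.
have ti := theta_inv_gt0; have m2 := m_ge2.
move=> ma; elim: n k => [|n IH] k.
  have /andP[h0 h1] := approximant_bounds 1 k ma.
  by rewrite expr0 [approximant a 0 k]/= subr0 ger0_norm// (le_trans h1)// ltW// theta_lt1.
rewrite exprS; apply: le_trans
  (_ : 2^-1 * `|approximant a n.+1 k.+1 - approximant a n k.+1| <= _).
  apply: inv_contraction.
  - by rewrite -theta_m ler_pM2l// ler_nat.
  - by have /andP[] := approximant_bounds n.+1 k.+1 ma.
  - by have /andP[] := approximant_bounds n k.+1 ma.
by rewrite ler_pM2l// invr_gt0.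
Qed.

Lemma approximant_cvg a k : (forall i, (m <= a i)%N) ->
  approximant a n k @[n --> \oo] --> tail a k.
Proof.
have ti := theta_inv_gt0; have m2 := m_ge2.
move=> ma.
suff : cvgn (fun n => approximant a n k) by [].
have -> : (fun n => approximant a n k) =
          series (fun n => approximant a n.+1 k - approximant a n k).
  apply/funext => n; rewrite /series /= telescope_sumr//= subr0//.
apply: normed_cvg.
apply: (@series_le_cvg _ _ (geometric 1 2^-1)) => //.
- by move=> n; exact: normr_ge0.
- by move=> n; rewrite /geometric /= mul1r exprn_ge0// invr_ge0.
- by move=> n; rewrite /geometric /= mul1r; exact: approximant_step.
- by apply: is_cvg_geometric_series; rewrite ger0_norm; lra.
Qed.

Lemma tail_ge0 a k : (forall i, (m <= a i)%N) -> 0 <= tail a k.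
Proof.
have ti := theta_inv_gt0; have m2 := m_ge2.
move=> ma; have cv : cvgn (fun n => approximant a n k) := approximant_cvg ma.
apply: (limr_ge cv).
by near=> n; have /andP[] := approximant_bounds n k ma.
Unshelve. all: end_near. Qed.

Lemma tailE a k : (forall i, (m <= a i)%N) ->
  tail a k = (theta * (a k)%:R + tail a k.+1)^-1.
Proof.
have ti := theta_inv_gt0; have m2 := m_ge2.
move=> ma.
have t0 := tail_ge0 k.+1 ma.
have h := denominator_ge k ma t0.
apply/(@cvg_lim R) => //.
rewrite -(cvg_shiftS (fun n => approximant a n k)) /=.
apply: cvgV; first by rewrite gt_eqF//; lra.
by apply: cvgD; [exact: cvg_cst|exact: approximant_cvg].
Qed.

(** Strictness matters on both sides: a tail equal to [0] would end the
    expansion, and a tail equal to [theta] would change the preceding digit. *)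
Lemma tail_bounds a k : (forall i, (m <= a i)%N) -> 0 < tail a k < theta.
Proof.
have ti := theta_inv_gt0; have m2 := m_ge2.
have pos j b : (forall i, (m <= b i)%N) -> 0 < tail b j.
  move=> mb; rewrite tailE// invr_gt0.
  have := denominator_ge j mb (tail_ge0 j.+1 mb); have := tail_ge0 j.+1 mb; lra.
move=> ma; rewrite pos//= tailE// -[ltRHS]invrK.
have t0 := pos k.+1 _ ma.
have h := denominator_ge k ma (ltW t0).
by rewrite ltf_pV2 ?posrE//; lra.
Qed.

Lemma tail_floor a k : (forall i, (m <= a i)%N) ->
  Num.floor (1 / (theta * tail a k)) = (a k)%:Z.
Proof.
have ti := theta_inv_gt0; have m2 := m_ge2.
move=> ma; apply: floor_def.
have /andP[t0 t1] := tail_bounds k.+1 ma.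
have -> : 1 / (theta * tail a k) = (a k)%:R + tail a k.+1 / theta.
  rewrite tailE// mul1r invfM invrK; field; exact: lt0r_neq0.
rewrite intrD -!pmulrn lerDl divr_ge0 1?ltW//=.
by rewrite ltrD2l ltr_pdivrMr// mul1r.
Qed.

Lemma gauss_map_tail a k : (forall i, (m <= a i)%N) ->
  gauss_map theta (tail a k) = tail a k.+1.
Proof.
have ti := theta_inv_gt0; have m2 := m_ge2.
move=> ma; rewrite /gauss_map gt_eqF; last by case/andP: (tail_bounds k ma).
by rewrite tail_floor// tailE// invrK -pmulrn; ring.
Qed.

Lemma digit_tail a k : (forall i, (m <= a i)%N) ->
  digit theta k.+1 (tail a 0) = (a k)%:R%:E.
Proof.
have ti := theta_inv_gt0; have m2 := m_ge2.
move=> ma; rewrite /digit /=.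
have -> : iter k (gauss_map theta) (tail a 0) = tail a k.
  by elim: k => //= k ->; exact: gauss_map_tail.
by rewrite gt_eqF ?tail_floor//; case/andP: (tail_bounds k ma).
Qed.

(** Two points of a cylinder are the images of their tails under one Moebius
    transformation; this is its difference quotient, written with
    [offset] and [cyl_length].  The induction peels off the last common digit. *)
Lemma tail_dist a b n : (forall i, (m <= a i)%N) -> (forall i, (m <= b i)%N) ->
  (forall i, (i < n)%N -> a i = b i) ->
  `|tail a 0 - tail b 0| * (1 + theta * offset R m a n * tail a n)
     * (1 + theta * offset R m a n * tail b n)
  = cyl_length R m a n * (1 + offset R m a n / m%:R) * `|tail a n - tail b n|.
Proof.
have ti := theta_inv_gt0; have m2 := m_ge2.
move=> ma mb; elim: n => [|n IH] ab /=.
  by rewrite mulr0 !mul0r !addr0 !mulr1 mul1r.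
have {IH} := IH (fun i ni => ab i (ltnW ni)).
rewrite (tailE n ma) (tailE n mb) -(ab n (leqnn _)).
set X := `|tail a 0 - _|; set t := offset R m a n; set L := cyl_length R m a n.
set u := tail a n.+1; set v := tail b n.+1; set c := (a n)%:R.
have am : m%:R <= c by rewrite ler_nat.
have /andP[t0 t1] : 0 <= t <= 1 := offset_bounds R m_gt1 (fun i (_ : (i < n)%N) => ma i).
have /andP[u0 _] : 0 < u < theta := tail_bounds n.+1 ma.
have /andP[v0 _] : 0 < v < theta := tail_bounds n.+1 mb.
have tc0 : 0 < theta * c by apply: mulr_gt0 => //; lra.
have -> : (theta * c + u)^-1 - (theta * c + v)^-1 =
          (v - u) * ((theta * c + u) * (theta * c + v))^-1 by field; lra.
have pos : 0 <= ((theta * c + u) * (theta * c + v))^-1.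
  by rewrite invr_ge0 mulr_ge0//; lra.
rewrite normrM distrC (ger0_norm pos).
set D := `|u - v| => IH.
have tE : theta * (m%:R / (c + t)) = (theta * (c + t))^-1.
  rewrite mulrA theta_m invfM//.
have tct : theta * (c + t) != 0 by rewrite mulf_neq0 ?gt_eqF//; lra.
apply: (@mulfI _ (theta ^+ 2 * (c + t) ^+ 2 * ((theta * c + u) * (theta * c + v))^-1)).
  by rewrite !mulf_neq0 ?invr_neq0 ?mulf_neq0 ?expf_neq0// ?gt_eqF//; lra.
rewrite tE.
transitivity (X * (1 + theta * t * (theta * c + u)^-1)
  * (1 + theta * t * (theta * c + v)^-1)).
  field. rewrite (gt_eqF theta_gt0) !gt_eqF//=; lra.
rewrite IH.
transitivity (L * (theta ^+ 2 * m%:R * (1 + t / m%:R))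
  * (D / ((theta * c + u) * (theta * c + v)))).
  by rewrite theta_sq; ring.
field. rewrite !gt_eqF//=; lra.
Qed.

(** Points in adjacent subcylinders can be close only near the common endpoint,
    which the point with the larger digit approaches only if its next digit is
    large.  This is why the bound [D] on the next digits enters. *)
Lemma tail_dist_ge a b n M D : (forall i, (m <= a i)%N) ->
  (forall i, (m <= b i)%N) -> (forall i, (i < n)%N -> a i = b i) ->
  a n <> b n -> (a n <= M)%N -> (b n <= M)%N ->
  (a n.+1 < D)%N -> (b n.+1 < D)%N ->
  cyl_length R m a n <= 4 * M.+1%:R ^+ 2 * D%:R * `|tail a 0 - tail b 0|.
Proof.
have ti := theta_inv_gt0; have m2 := m_ge2.
move=> ma mb ab abn aM bM aD bD.
have sep x y j : (forall i, (m <= x i)%N) -> (forall i, (m <= y i)%N) ->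
    (x j < y j)%N -> (y j <= M)%N -> (y j.+1 < D)%N ->
    1 <= M.+1%:R ^+ 2 * D%:R * `|tail x j - tail y j|.
  move=> mx my xy yM yD.
  have /andP[u0 u1] := tail_bounds j.+1 mx.
  have /andP[v0 v1] := tail_bounds j.+1 my.
  have /andP[w0 w1] := tail_bounds j.+2 my.
  have vD : 1 <= D%:R * tail y j.+1.
    rewrite tailE// ler_pdivlMr ?mul1r; last first.
      by have := denominator_ge j.+1 my (ltW w0); lra.
    apply: le_trans (_ : (y j.+1).+1%:R <= _); last by rewrite ler_nat.
    rewrite -natr1 lerD//; last by have := theta_lt1; lra.
    by rewrite ler_piMl// ltW// theta_lt1.
  have tx := denominator_ge j mx (ltW u0).
  have ty := denominator_ge j my (ltW v0).
  have Mbound z : (z j <= M)%N -> forall r, r < theta -> theta * (z j)%:R + r <= M.+1%:R.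
    move=> zM r rt; rewrite -natr1.
    have zM' : (z j)%:R <= M%:R :> R by rewrite ler_nat.
    have := theta_lt1; have : 0 <= (z j)%:R :> R by []. nra.
  have Mx := Mbound x (ltnW (leq_trans xy yM)) _ u1.
  have My := Mbound y yM _ v1.
  rewrite (tailE j mx) (tailE j my).
  set p := theta * (x j)%:R + _; set q := theta * (y j)%:R + _.
  have p0 : 0 < p by rewrite /p; lra.
  have q0 : 0 < q by rewrite /q; lra.
  have -> : p^-1 - q^-1 = (q - p) * (p * q)^-1 by field; lra.
  have qp : tail y j.+1 <= q - p.
    have : (x j)%:R + 1 <= (y j)%:R :> R by rewrite natr1 ler_nat.
    rewrite /p /q; nra.
  rewrite ger0_norm; last by rewrite mulr_ge0 ?invr_ge0 ?mulr_ge0//; lra.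
  rewrite mulrA ler_pdivlMr ?mulr_gt0// mul1r.
  apply: le_trans (_ : M.+1%:R ^+ 2 <= _).
    by rewrite expr2 ler_pM// ltW.
  rewrite -mulrA ler_peMr ?exprn_ge0//.
  by apply: le_trans vD _; rewrite ler_wpM2l.
have {sep} sep : 1 <= M.+1%:R ^+ 2 * D%:R * `|tail a n - tail b n|.
  by case: (ltngtP (a n) (b n)) => // h; [exact: sep|rewrite distrC; exact: sep].
have := tail_dist ma mb ab.
have L0 := cyl_length_gt0 R m_gt1 n ma.
have /andP[t0 t1] := offset_bounds R m_gt1 (fun i (_ : (i < n)%N) => ma i).
have half u : 0 < u < theta -> 0 <= 1 + theta * offset R m a n * u <= 2.
  move=> /andP[u0 u1]; have := theta_lt1 => th1.
  have p0 : 0 <= theta * offset R m a n by rewrite mulr_ge0// ltW.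
  have p1 : theta * offset R m a n <= 1 by rewrite mulr_ile1// ltW.
  have q0 : 0 <= theta * offset R m a n * u by rewrite mulr_ge0// ltW.
  have q1 : theta * offset R m a n * u <= 1 by rewrite mulr_ile1//; lra.
  lra.
have /andP[p0 p1] := half _ (tail_bounds n ma).
have /andP[q0 q1] := half _ (tail_bounds n mb).
set X := `|tail a 0 - _|; set Y := `|tail a n - _| => E.
have X0 : 0 <= X by exact: normr_ge0.
have Y0 : 0 <= Y by exact: normr_ge0.
have X4 : X * (1 + theta * offset R m a n * tail a n)
    * (1 + theta * offset R m a n * tail b n) <= 4 * X.
  have -> : (4 : R) = 2 * 2 by ring.
  rewrite -mulrA [leRHS]mulrC; apply: ler_wpM2l => //.
  by apply: ler_pM.
have LY : cyl_length R m a n * Y <= 4 * X.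
  apply: le_trans X4; rewrite E ler_wpM2r// ler_peMr ?(ltW L0)//.
  by rewrite lerDl divr_ge0.
apply: le_trans (_ : (M.+1%:R ^+ 2 * D%:R * Y) * cyl_length R m a n <= _).
  by rewrite ler_peMl// ltW.
have -> : 4 * M.+1%:R ^+ 2 * D%:R * X = M.+1%:R ^+ 2 * D%:R * (4 * X) by ring.
by rewrite -mulrA [Y * _]mulrC ler_wpM2l// mulr_ge0// exprn_ge0.
Qed.

End Tail.

(** * Coding the unit interval by digit sequences *)

Lemma linear_le_exprn (R : realType) (K : R) n : 1 < K ->
  n%:R * (K - 1) <= K ^+ n.
Proof.
move=> K1; elim: n => [|n IH]; first by rewrite mul0r ler01.
rewrite exprS -natr1.
have : 1 <= K ^+ n by rewrite exprn_ege1// ltW.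
have := mulr_ge0 (_ : 0 <= K - 1) (_ : 0 <= K ^+ n - 1); nra.
Qed.

Section Coding.
Variables (R : realType) (m M : nat) (rule : nat -> nat -> option nat).
Hypotheses (m_gt1 : (1 < m)%N) (m_leM : (m <= M)%N)
  (rule_ge : forall n S d, rule n S = Some d -> (m <= d)%N).
Implicit Types (tau t u s K : R) (c : nat -> nat).

(** The proportion of a cylinder of offset [tau] covered by the subcylinders of
    the digits from [m] to [M]. *)
Definition free_mass tau := 1 - (m%:R + tau) / (M.+1%:R + tau).

(** The position of a point in a cylinder of offset [tau] is an affine function
    of [1 / (y + tau)], where [1 / (theta * y)] is its tail, and the digit is the
    integer part of [y].  The reals [t] of [ [0, 1[ ] run affinely through the part
    of the cylinder with digits from [m] to [M], and [coord tau t] is the value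
    of [1 / (y + tau)] at [t]. *)
Definition coord tau t := (1 - t * free_mass tau) / (m%:R + tau).

Definition free_digit tau t := Num.truncn ((coord tau t)^-1 - tau).

(** The position of [t] inside the part of [ [0, 1[ ] given to the digit [a],
    rescaled to [ [0, 1[ ]. *)
Definition free_rest tau t (a : nat) :=
  (a%:R + 1 + tau) * (1 - (a%:R + tau) * coord tau t).

Lemma free_mass_bounds tau : 0 <= tau -> 0 < free_mass tau < 1.
Proof.
move=> tau0; rewrite /free_mass.
have m0 : 0 < m%:R :> R by rewrite ltr0n (ltn_trans _ m_gt1).
have mM : m%:R < M.+1%:R :> R by rewrite ltr_nat ltnS.
rewrite subr_gt0 ltr_pdivrMr ?ltrBlDr ?ltrDl ?divr_gt0//; lra.
Qed.

Lemma coord_bounds tau t : 0 <= tau -> 0 <= t < 1 ->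
  (M.+1%:R + tau)^-1 < coord tau t <= (m%:R + tau)^-1.
Proof.
move=> tau0 /andP[t0 t1].
have m0 : 0 < m%:R :> R by rewrite ltr0n (ltn_trans _ m_gt1).
have M0 : 0 < M.+1%:R :> R by [].
have /andP[z0 z1] := free_mass_bounds tau0.
have tz : t * free_mass tau < free_mass tau by rewrite gtr_pMl.
have tz0 : 0 <= t * free_mass tau by rewrite mulr_ge0// ltW.
rewrite /coord; apply/andP; split.
  rewrite ltr_pdivlMr; last by lra.
  rewrite mulrC; move: tz; rewrite {2}/free_mass; lra.
by rewrite ler_pdivrMr ?mulVf ?gt_eqF//; lra.
Qed.

Lemma coord_gt0 tau t : 0 <= tau -> 0 <= t < 1 -> 0 < coord tau t.
Proof.
move=> tau0 t01; have /andP[s0 _] := coord_bounds tau0 t01.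
by apply: lt_trans s0; rewrite invr_gt0 ltr_wpDr.
Qed.

Lemma coord_inv_bounds tau t : 0 <= tau -> 0 <= t < 1 ->
  m%:R <= (coord tau t)^-1 - tau < M.+1%:R.
Proof.
move=> tau0 t01; have /andP[s0 s1] := coord_bounds tau0 t01.
have m0 : 0 < m%:R + tau by rewrite ltr_wpDr// ltr0n (ltn_trans _ m_gt1).
have M0 : 0 < M.+1%:R + tau by rewrite ltr_wpDr.
have w0 := coord_gt0 tau0 t01.
rewrite lerBrDr ltrBlDr; apply/andP; split.
  by rewrite -[leLHS]invrK lef_pV2 ?posrE ?invr_gt0.
by rewrite -[ltRHS]invrK ltf_pV2 ?posrE ?invr_gt0.
Qed.

Lemma free_digit_itv tau t : 0 <= tau -> 0 <= t < 1 ->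
  (free_digit tau t)%:R <= (coord tau t)^-1 - tau < (free_digit tau t).+1%:R.
Proof.
move=> tau0 t01; have /andP[h _] := coord_inv_bounds tau0 t01.
by apply: truncn_itv; exact: le_trans h.
Qed.

Lemma free_digit_bounds tau t : 0 <= tau -> 0 <= t < 1 ->
  (m <= free_digit tau t <= M)%N.
Proof.
move=> tau0 t01; have /andP[h0 h1] := coord_inv_bounds tau0 t01.
have /andP[d0 d1] := free_digit_itv tau0 t01.
by rewrite -ltnS -(ltr_nat R) (le_lt_trans h0 d1) -ltnS -(ltr_nat R) (le_lt_trans d0 h1).
Qed.

Lemma free_rest_bounds tau t : 0 <= tau -> 0 <= t < 1 ->
  0 <= free_rest tau t (free_digit tau t) < 1.
Proof.
move=> tau0 t01.
have m0 : 0 < m%:R :> R by rewrite ltr0n (ltn_trans _ m_gt1).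
have M0 : 0 < M.+1%:R :> R by [].
have /andP[s0 s1] := coord_bounds tau0 t01.
have /andP[d0 d1] := free_digit_itv tau0 t01.
have sl0 := coord_gt0 tau0 t01.
have /andP[a1 _] := free_digit_bounds tau0 t01.
rewrite /free_rest; move: d0 d1 a1; set a := free_digit tau t.
rewrite -(ler_nat R) -natr1 => d0 d1 a1.
set w := coord tau t in sl0 d0 d1 *.
have h0 : (a%:R + tau) * w <= 1 by rewrite -ler_pdivlMr// div1r; lra.
have h1 : 1 < (a%:R + 1 + tau) * w by rewrite -ltr_pdivrMr// div1r; lra.
rewrite mulr_ge0 ?subr_ge0//=; last by lra.
have : 0 < (a%:R + tau) * ((a%:R + 1 + tau) * w - 1).
  by rewrite mulr_gt0 ?subr_gt0//; lra.
lra.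
Qed.

(** The state consists of the sum of the digits chosen so far, the offset of the
    current cylinder and the rescaled position in it; an imposed digit consumes
    no information about the position.  The first component returned is the
    new digit. *)
Definition step n (st : nat * R * R) : nat * (nat * R * R) :=
  let: (sm, tau, t) := st in
  if rule n sm is Some d then (d, ((sm + d)%N, m%:R / (d%:R + tau), t))
  else let a := free_digit tau t in
       (a, ((sm + a)%N, m%:R / (a%:R + tau), free_rest tau t a)).

Fixpoint state t n : nat * R * R :=
  if n is n'.+1 then (step n' (state t n')).2 else (0%N, 0, t).

Definition coding t n : nat := (step n (state t n)).1.

Definition residue t n : R := (state t n).2.

Lemma stateE t n :
  state t n = ((\sum_(i < n) coding t i)%N, offset R m (coding t) n, residue t n).
Proof.
elim: n => [|n IH]; first by rewrite big_ord0.
rewrite big_ord_recr /residue /= [coding t n]/coding IH /step.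
by case: (rule _ _).
Qed.

Lemma coding_forced t n d : rule n (\sum_(i < n) coding t i) = Some d ->
  coding t n = d /\ residue t n.+1 = residue t n.
Proof. by move=> e; rewrite /residue/coding /= stateE /= e. Qed.

Lemma coding_free t n : rule n (\sum_(i < n) coding t i) = None ->
  coding t n = free_digit (offset R m (coding t) n) (residue t n) /\
  residue t n.+1 = free_rest (offset R m (coding t) n) (residue t n) (coding t n).
Proof. by move=> e; rewrite {2}/residue /coding /= stateE /= e. Qed.

Lemma coding_residue_bounds t n : 0 <= t < 1 ->
  (forall i, (i < n)%N -> (m <= coding t i)%N) /\ 0 <= residue t n < 1.
Proof.
move=> t01; elim: n => [|n [IH1 IH2]]; first by split.
have /andP[tau0 _] := offset_bounds R m_gt1 IH1.
suff [h1 h2] : (m <= coding t n)%N /\ 0 <= residue t n.+1 < 1.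
  by split => // i; rewrite ltnS leq_eqVlt => /predU1P[->//|]; exact: IH1.
case e : (rule n (\sum_(i < n) coding t i)) => [d|].
  by have [-> ->] := coding_forced e; split => //; exact: rule_ge e.
have [ea ->] := coding_free e; rewrite ea; split.
  by case/andP: (free_digit_bounds tau0 IH2).
exact: free_rest_bounds.
Qed.

Lemma coding_ge t : 0 <= t < 1 -> forall i, (m <= coding t i)%N.
Proof. by move=> t01 i; have [h _] := coding_residue_bounds i.+1 t01; exact: h. Qed.

Lemma residue_bounds t n : 0 <= t < 1 -> 0 <= residue t n < 1.
Proof. by move=> t01; have [] := coding_residue_bounds n t01. Qed.

Lemma coding_free_le t n : 0 <= t < 1 ->
  rule n (\sum_(i < n) coding t i) = None -> (coding t n <= M)%N.
Proof.
move=> t01 e; have [-> _] := coding_free e.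
have /andP[tau0 _] := offset_bounds R m_gt1 (fun i (_ : (i < n)%N) => coding_ge t01 i).
by have /andP[] := free_digit_bounds tau0 (residue_bounds n t01).
Qed.

(** The loss of imposed digits over the gain of free ones in [coding_dist]. *)
Fixpoint weight K c n : R :=
  if n is n'.+1 then weight K c n' *
    (if rule n' (\sum_(i < n') c i) is Some d then d.+1%:R ^+ 2 else K^-1)
  else 1.

Lemma weight_ge0 K c n : 0 < K -> 0 <= weight K c n.
Proof.
move=> K0; elim: n => //= n IH; rewrite mulr_ge0//; case: (rule _ _) => [d|].
  by rewrite exprn_ge0.
by rewrite invr_ge0 ltW.
Qed.

(** One more common digit divides the distance of the rescaled positions by the
    probability of that digit.  A free digit of relative length [r <= 1/2] has
    probability [r / free_mass], at most [r ^ s / K] by the choice of [K]; an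
    imposed one has probability 1, at most [r ^ s * (d + 1) ^ 2]. *)
Lemma coding_dist K s t u n : 0 < K -> 0 <= s < 1 ->
  (forall tau, 0 <= tau <= 1 -> 2^-1 `^ (1 - s) * K <= free_mass tau) ->
  0 <= t < 1 -> 0 <= u < 1 ->
  (forall i, (i < n)%N -> coding t i = coding u i) ->
  `|t - u| <= weight K (coding t) n * cyl_length R m (coding t) n `^ s
              * `|residue t n - residue u n|.
Proof.
move=> K0 /andP[s0 s1] KZ t01 u01; elim: n => [|n IH] tu.
  by rewrite /= powR1 !mul1r.
have {}IH := IH (fun i ni => tu i (ltnW ni)).
have cS : (\sum_(i < n) coding u i = \sum_(i < n) coding t i)%N.
  by apply: eq_bigr => i _; rewrite tu// ltnS ltnW.
have cT : offset R m (coding u) n = offset R m (coding t) n.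
  by apply: eq_offset => i ni; rewrite tu// ltnS ltnW.
have ct := coding_ge t01 n.
have tau01 := offset_bounds R m_gt1 (fun i (_ : (i < n)%N) => coding_ge t01 i).
have /andP[tau0 tau1] := tau01.
have L0 : 0 < cyl_length R m (coding t) n by apply: cyl_length_gt0 => //; exact: coding_ge.
rewrite /=; apply: le_trans IH _; rewrite -!mulrA ler_wpM2l ?weight_ge0//.
set a := coding t n in ct *; set tau := offset _ _ _ _ in tau0 tau1 tau01 cT *.
have ma : m%:R <= a%:R :> R by rewrite ler_nat.
have m2 : 2 <= m%:R :> R by rewrite ler_nat.
set r := (m%:R + tau) / _.
have r0 : 0 < r by rewrite /r divr_gt0// ?mulr_gt0//; lra.
have r2 : r <= 2^-1.
  rewrite /r ler_pdivrMr ?mulr_gt0//; [|lra|lra].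
  have : 0 <= (a%:R + tau) * (a%:R + tau - 1) by rewrite mulr_ge0//; lra.
  lra.
rewrite (powRM _ (ltW L0) (ltW r0)).
rewrite -[X in _ <= _ * X]mulrA [leRHS]mulrCA.
rewrite ler_wpM2l ?powR_ge0//.
have rs : r <= r `^ s.
  by apply: ger1_powR; [rewrite r0 /=; lra|exact: ltW].
rewrite mulrA; case e : (rule n _) => [d|].
  have [ed ->] := coding_forced e.
  have [_ ->] := coding_forced (etrans (congr1 (rule n) cS) e).
  rewrite ler_peMl// -ed -/a.
  apply: le_trans (_ : a.+1%:R ^+ 2 * r <= _); last by rewrite ler_wpM2l ?exprn_ge0.
  rewrite /r mulrA ler_pdivlMr ?mulr_gt0//; [|lra|lra].
  rewrite -natr1 mul1r; nra.
have [ea ->] := coding_free e.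
have [eb ->] := coding_free (etrans (congr1 (rule n) cS) e).
rewrite -(tu n (leqnn _)) cT -/tau -/a.
have /andP[z0 _] := free_mass_bounds tau0.
have -> : free_rest tau (residue t n) a - free_rest tau (residue u n) a =
    (residue t n - residue u n) * (free_mass tau / r).
  rewrite /free_rest /coord /r; field.
  by rewrite !gt_eqF//; lra.
rewrite normrM (ger0_norm (_ : 0 <= free_mass tau / r)); last first.
  by rewrite divr_ge0// ltW.
have rK : r * K <= r `^ s * free_mass tau.
  have {1}-> : r = r `^ s * r `^ (1 - s).
    rewrite -powRD; last by rewrite gt_eqF//; lra.
    by rewrite addrC subrK powRr1// ltW.
  rewrite -mulrA ler_wpM2l ?powR_ge0//; apply: le_trans (KZ _ tau01).
  rewrite ler_wpM2r ?(ltW K0)// ge0_ler_powR ?nnegrE//; first by lra.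
  by rewrite ltW.
rewrite mulrCA ler_peMr//.
have -> : K^-1 * r `^ s * (free_mass tau / r) = (r `^ s * free_mass tau) / (r * K).
  by field; rewrite !gt_eqF.
have rK0 : 0 < r * K by rewrite mulr_gt0.
by rewrite (ler_pdivlMr _ _ rK0) mul1r.
Qed.

End Coding.

(** * Bounds on Hausdorff measure and dimension *)

Section HausdorffBounds.
Variable R : realType.
Implicit Types (A U N : set R) (s x y : R).

Lemma diam_ge0 U : (0 <= diam U)%E.
Proof. by rewrite /diam le_max lexx. Qed.

Lemma dist_le_diam U x y : U x -> U y -> (`|x - y|%:E <= diam U)%E.
Proof.
move=> Ux Uy; rewrite /diam le_max; apply/orP; right.
by apply: ereal_sup_ubound; exists (x, y).
Qed.

Lemma diam_le U (d : R) : 0 <= d -> (forall x y, U x -> U y -> `|x - y| <= d) ->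
  (diam U <= d%:E)%E.
Proof.
move=> d0 Ud; rewrite /diam ge_max lee_fin d0 /=; apply: ge_ereal_sup.
by move=> _ [[x y] [Ux Uy] <-]; rewrite lee_fin; exact: Ud.
Qed.

Lemma diam_fin U (d : R) : (diam U <= d%:E)%E ->
  exists2 e : R, 0 <= e & diam U = e%:E.
Proof.
move=> Ud; exists (fine (diam U)); first by rewrite fine_ge0// diam_ge0.
rewrite fineK// ge0_fin_numE ?diam_ge0//; exact: le_lt_trans Ud (ltry _).
Qed.

Lemma hausdorff_content_ge0 (delta s : R) A : (0 <= hausdorff_content delta s A)%E.
Proof.
apply: le_ereal_inf_tmp => _ [U _ <-].
by apply: nneseries_ge0 => i _ _; exact: poweR_ge0.
Qed.

(** The preimages under [g] of the sets of a cover of [A], together with [N],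
    cover [ [0, 1[ ], and each of them lies in an interval of length
    [2 * C * diam U ^ s]; so the sum of these lengths is at least 1. *)
Lemma hausdorff_measure_neq0 A N (s C : R) (g : R -> R) :
  0 <= s -> 0 < C -> countable N ->
  (forall t : R, 0 <= t < 1 -> ~ N t -> A (g t)) ->
  (forall t u : R, 0 <= t < 1 -> 0 <= u < 1 -> `|t - u| <= C * `|g t - g u| `^ s) ->
  hausdorff_measure s A <> 0%E.
Proof.
move=> s0 C0 cN gA hol.
suff h : (((2 * C)^-1)%:E <= hausdorff_content 1 s A)%E.
  have : (0 < hausdorff_measure s A)%E.
    apply: lt_le_trans (_ : (((2 * C)^-1)%:E <= _)%E).
      by rewrite lte_fin invr_gt0 mulr_gt0.
    apply: le_trans h _; apply: ereal_sup_ubound; exists 1 => //=; exact: ltr01.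
  by move=> + e; rewrite e ltxx.
apply: le_ereal_inf_tmp => _ [U [AU Ud] <-].
have cover i : exists V : set R, [/\ measurable V,
    (lebesgue_measure V <= (2 * C)%:E * (if U i != set0 then diam (U i) `^ s else 0))%E
    & forall t, 0 <= t < 1 -> U i (g t) -> V t].
  have [d d0 Ed] := diam_fin (Ud i).
  have [[t0 [t01 Ut0]]|no] := pselect (exists t0, 0 <= t0 < 1 /\ U i (g t0)); last first.
    exists set0; split => //.
      rewrite measure0 mule_ge0 ?lee_fin ?mulr_ge0 ?(ltW C0)//.
      by case: ifP => // _; exact: poweR_ge0.
    by move=> t t01 Ut; apply: no; exists t.
  set r := C * d `^ s.
  have r0 : 0 <= r by rewrite mulr_ge0 ?powR_ge0// ltW.
  exists `[t0 - r, t0 + r]%classic; split.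
  - exact: measurable_itv.
  - rewrite (_ : U i != set0); last by apply/set0P; exists (g t0).
    rewrite lebesgue_measure_itv /= lte_fin Ed poweR_EFin -EFinM.
    have -> : 2 * C * d `^ s = t0 + r - (t0 - r) by rewrite /r; ring.
    case: ifP => // _; rewrite lee_fin; lra.
  move=> t tt Ut; rewrite /= in_itv /=.
  have := hol _ _ tt t01.
  have : `|g t - g t0| <= d by rewrite -lee_fin -Ed; exact: dist_le_diam.
  move=> gd tr; have {gd} : `|t - t0| <= r.
    apply: le_trans tr _; rewrite ler_wpM2l ?(ltW C0)//.
    by apply: ge0_ler_powR => //; rewrite nnegrE.
  by rewrite ler_norml; lra.
have /choice[V hV] := cover.
have mV i : measurable (V i) by have [] := hV i.
have mN : measurable N by apply: countable_measurable => // t; exact: measurable_set1.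
have mU : measurable (\bigcup_i V i) by exact: bigcup_measurable.
have : (1 <= (2 * C)%:E * \sum_(0 <= i <oo | U i != set0) diam (U i) `^ s)%E.
  have -> : 1%E = lebesgue_measure (`[0, 1[%classic : set R).
    by rewrite lebesgue_measure_itv /= lte_fin ltr01 oppr0 adde0.
  apply: (@le_trans _ _ (lebesgue_measure (N `|` \bigcup_i V i))).
    apply: le_measure; rewrite ?inE//; first exact: measurableU.
    move=> t /=; rewrite in_itv /= => t01.
    have [Nt|Nt] := pselect (N t); [by left|right].
    have [i _ Ui] := AU _ (gA _ t01 Nt).
    by exists i => //; have [_ _] := hV i; exact.
  apply: (@le_trans _ _ (lebesgue_measure N + lebesgue_measure (\bigcup_i V i))%E).
    exact: measureU2.
  rewrite countable_lebesgue_measure0// add0e.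
  apply: (@le_trans _ _ (\sum_(0 <= i <oo) lebesgue_measure (V i))%E).
    exact: measure_sigma_subadditive.
  rewrite -nneseriesZl; last by move=> i _; exact: poweR_ge0.
  rewrite [leRHS]eseries_mkcond; apply: lee_nneseries => // i _.
  by have [_ + _] := hV i; case: ifP => // _; rewrite mule0.
move=> h; rewrite -(@lee_pmul2l _ (2 * C)%:E) ?lte_fin ?mulr_gt0//.
by rewrite -EFinM mulfV// gt_eqF// mulr_gt0.
Qed.

Lemma hausdorff_measure_eq0 A s : 1 < s -> A `<=` `[0, 1] ->
  hausdorff_measure s A = 0%E.
Proof.
move=> s1 A01; apply/eqP; rewrite eq_le; apply/andP; split; last first.
  apply: le_trans (hausdorff_content_ge0 1 s A) _.
  by apply: ereal_sup_ubound; exists 1 => //=; exact: ltr01.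
apply: ge_ereal_sup => _ [delta /= delta0 <-].
apply/lee_addgt0Pr => e e0; rewrite add0e.
pose b := Num.min delta (e `^ (s - 1)^-1).
have b0 : 0 < b by rewrite lt_min delta0 powR_gt0.
(* The unit interval is cut into [n] intervals of length [1 / n <= b], whose
   sum is [n * n ^ (- s) = n ^ (1 - s)], at most [b ^ (s - 1) <= e]. *)
pose n := (Num.truncn b^-1).+1.
have nb : n%:R^-1 <= b.
  rewrite -[leRHS]invrK lef_pV2 ?posrE ?invr_gt0//.
  have bV0 : 0 <= b^-1 by rewrite invr_ge0 ltW.
  by have /andP[_ /ltW] := truncn_itv bV0.
pose U i := if (i < n)%N then `[i%:R / n%:R, i.+1%:R / n%:R]%classic else set0 : set R.
have dU i : (diam (U i) <= (n%:R^-1)%:E)%E.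
  apply: diam_le; first by rewrite invr_ge0.
  move=> x y; rewrite /U; case: ifP => //= _.
  rewrite !in_itv /= -natr1 mulrDl mul1r => h1 h2.
  rewrite ler_norml; lra.
apply: le_trans (_ : (\sum_(0 <= i <oo | U i != set0) diam (U i) `^ s <= _)%E).
  apply: ereal_inf_lbound; exists U => //; split.
    move=> x /A01 /=; rewrite in_itv /= => /andP[x0 x1].
    have n0 : 0 < n%:R :> R by rewrite ltr0n.
    have [->|xn1] := eqVneq x 1.
      exists n.-1 => //; rewrite /U /= leqnn /= in_itv /=.
      rewrite ler_pdivrMr// mul1r ler_nat leqnSn/=.
      by rewrite divff// gt_eqF.
    have xn : 0 <= x * n%:R by rewrite mulr_ge0.
    have /andP[t0 t1] := truncn_itv xn.
    exists (Num.truncn (x * n%:R)) => //; rewrite /U.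
    rewrite ifT; last first.
      rewrite -(ltr_nat R); apply: le_lt_trans t0 _.
      by rewrite gtr_pMl// lt_neqAle xn1.
    by rewrite /= in_itv /= ler_pdivrMr// t0 /= ler_pdivlMr// ltW.
  move=> i; apply: le_trans (dU i) _; rewrite lee_fin; apply: le_trans nb _.
  by rewrite ge_min lexx.
rewrite eseries_mkcond (@nneseries_split _ _ 0 n); last first.
  by move=> i _; case: ifP => // _; exact: poweR_ge0.
rewrite [X in (_ + X <= _)%E]eseries0 ?adde0; last first.
  by move=> i; rewrite add0n leqNgt => /negbTE ni _; rewrite /U ni eqxx.
apply: (@le_trans _ _ (\sum_(0 <= i < n) (n%:R^-1 `^ s)%:E)%E).
  rewrite add0n; apply: lee_sum => i _; case: ifP => _; last by rewrite lee_fin powR_ge0.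
  have [d d0 Ed] := diam_fin (dU i).
  have := dU i; rewrite Ed poweR_EFin !lee_fin => dn.
  by apply: ge0_ler_powR => //; rewrite ?nnegrE ?invr_ge0//; lra.
rewrite sumEFin lee_fin sumr_const_nat subn0 -[leLHS]mulr_natl.
have n0 : 0 < n%:R :> R by rewrite ltr0n.
have -> : n%:R * n%:R^-1 `^ s = n%:R^-1 `^ (s - 1).
  have nV0 : 0 < n%:R^-1 :> R by rewrite invr_gt0.
  by rewrite powRB ?(gt_eqF nV0) ?implybT// powRr1 ?(ltW nV0)// invrK mulrC.
have -> : e = (e `^ (s - 1)^-1) `^ (s - 1).
  by rewrite -powRrM mulVf ?powRr1 ?ltW// gt_eqF//; lra.
apply: ge0_ler_powR; rewrite ?nnegrE ?invr_ge0 ?powR_ge0//; first by lra.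
by apply: le_trans nb _; rewrite ge_min lexx orbT.
Qed.

Lemma hausdorff_dim_eq1 A : A `<=` `[0, 1] ->
  (forall s, 0 <= s < 1 -> hausdorff_measure s A <> 0%E) ->
  hausdorff_dim A = 1%E.
Proof.
move=> A01 A0; apply/eqP; rewrite eq_le; apply/andP; split.
  apply/lee_addgt0Pr => e e0; apply: ereal_inf_lbound; exists (1 + e) => //; split.
    by lra.
  by apply: hausdorff_measure_eq0 => //; lra.
apply: le_ereal_inf_tmp => _ [s [s0 sA] <-]; rewrite lee_fin leNgt; apply/negP => s1.
by apply: (A0 s) => //; rewrite s0.
Qed.

End HausdorffBounds.

(** * Growth of the normalising factor along the cubes *)

Section LogLog.
Variable R : realType.
Implicit Types (n k : nat).

Definition loglog n : R := ln n%:R * ln (ln n%:R).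

(** Beyond [exp (exp 1)] the iterated logarithm is at least 1, which makes
    [loglog] positive and nondecreasing. *)
Definition loglog_start : nat := (Num.truncn (expR (expR 1 : R))).+1.

Lemma ln_large n : (loglog_start <= n)%N -> expR 1 <= ln (n%:R : R).
Proof.
move=> hn; rewrite -ler_expR lnK; last first.
  by rewrite posrE ltr0n; apply: leq_trans hn.
have /andP[_ /ltW h] := truncn_itv (expR_ge0 (expR 1 : R)).
by apply: le_trans h _; rewrite ler_nat.
Qed.

Lemma lnln_large n : (loglog_start <= n)%N ->
  2 <= ln (n%:R : R) /\ 1 <= ln (ln (n%:R : R)).
Proof.
move=> hn; have h := ln_large hn.
have e2 : 2 <= expR (1 : R) by apply: le_trans (expR_ge1Dx 1); lra.
split; first lra.
by rewrite -ler_expR lnK// posrE; lra.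
Qed.

Lemma loglog_ge_ln n : (loglog_start <= n)%N -> ln (n%:R : R) <= loglog n.
Proof. by move=> /lnln_large[h1 h2]; rewrite /loglog ler_peMr//; lra. Qed.

Lemma loglog_ge1 n : (loglog_start <= n)%N -> 1 <= loglog n.
Proof.
by move=> h; apply: le_trans (loglog_ge_ln h); have [] := lnln_large h; lra.
Qed.

Lemma loglog_homo n k : (loglog_start <= n)%N -> (n <= k)%N ->
  loglog n <= loglog k.
Proof.
move=> hn nk; have [h1 h2] := lnln_large hn.
have [h3 h4] := lnln_large (leq_trans hn nk).
have n0 : (0 < n)%N by apply: leq_trans hn.
have lnk : ln (n%:R : R) <= ln k%:R.
  by rewrite ler_ln ?posrE ?ltr0n ?ler_nat//; exact: leq_trans nk.
rewrite /loglog ler_pM//; [lra|lra|].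
by rewrite ler_ln// posrE; lra.
Qed.

Lemma ln_cube k : (0 < k)%N -> ln ((k ^ 3)%:R : R) = 3 * ln k%:R.
Proof. by move=> k0; rewrite natrX lnXn ?ltr0n// mulr_natl. Qed.

Lemma loglog_cube_le k : (loglog_start <= k ^ 3)%N ->
  loglog (k ^ 3) <= 9 * k%:R ^+ 2.
Proof.
move=> h; have k0 : (0 < k)%N by case: k h => //; rewrite exp0n.
have [h1 h2] := lnln_large h.
have h3 : ln (k ^ 3)%:R <= 3 * k%:R :> R.
  by rewrite ln_cube// ler_pM2l// ltW// ln_sublinear// ltr0n.
have h4 : ln (ln (k ^ 3)%:R) <= 3 * k%:R :> R.
  by apply: le_trans h3; apply/ltW/ln_sublinear; lra.
have -> : 9 * k%:R ^+ 2 = 3 * k%:R * (3 * k%:R) :> R by ring.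
by rewrite /loglog ler_pM//; lra.
Qed.

Lemma ln_le_sqrt (x : R) : 0 < x -> ln x <= 2 * Num.sqrt x.
Proof.
move=> x0; rewrite -{1}(sqr_sqrtr (ltW x0)) lnXn ?sqrtr_gt0// -[leLHS]mulr_natl ler_pM2l//.
by apply/ltW/ln_sublinear; rewrite sqrtr_gt0.
Qed.

(** With [a] and [b] the logarithms of consecutive cubes, the increment of
    [x * ln x] from [a] to [b] is at most [(b - a) * (ln b + 1)]; here
    [b - a <= 3 / k], and [ln b] is bounded by a multiple of the square root
    of [k]. *)
Lemma loglog_cube_step (e : R) k : 0 < e -> (loglog_start <= k)%N ->
  21 ^+ 2 <= e ^+ 2 * k%:R ->
  loglog (k.+1 ^ 3) - loglog (k ^ 3) <= e.
Proof.
move=> e0 hk ek; have k0 : (0 < k)%N by apply: leq_trans hk.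
have kR : 1 <= k%:R :> R by rewrite ler1n.
have k3 : (k <= k ^ 3)%N by rewrite -{1}[k]expn1 leq_pexp2l.
have [a2 _] := lnln_large (leq_trans hk k3).
rewrite /loglog !ln_cube//; rewrite ln_cube// in a2.
set a := 3 * ln k%:R in a2 *; set b := 3 * ln k.+1%:R.
have ba : b - a <= 3 / k%:R.
  have -> : b - a = 3 * ln (1 + k%:R^-1).
    have -> : 1 + k%:R^-1 = k.+1%:R / k%:R :> R.
      by rewrite -natr1; field; rewrite gt_eqF//; lra.
    by rewrite ln_div ?posrE ?ltr0n// /a /b; ring.
  rewrite ler_pM2l// le_ln1Dx//.
  by apply: lt_le_trans (_ : 0 <= _); rewrite ?ltrN10// invr_ge0; lra.
have ab : a <= b.
  by rewrite /a /b ler_pM2l// ler_ln ?posrE ?ltr0n// ler_nat.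
have lnab : a * (ln b - ln a) <= b - a.
  rewrite -ln_div ?posrE; [|lra|lra].
  have -> : b / a = 1 + (b / a - 1) by ring.
  apply: le_trans (_ : a * (b / a - 1) <= _).
    rewrite ler_pM2l; last by lra.
    rewrite le_ln1Dx//.
    have : 0 < b / a by rewrite divr_gt0//; lra.
    lra.
  by rewrite mulrBr mulr1 mulrCA divff ?mulr1// gt_eqF//; lra.
have sk0 : 1 <= Num.sqrt k%:R :> R by rewrite -[leLHS]sqrtr1; exact: ler_wsqrtr.
have skk : Num.sqrt k%:R ^+ 2 = k%:R :> R by rewrite sqr_sqrtr//; lra.
set q := Num.sqrt k%:R in sk0 skk.
have lnb : ln b <= 6 * q.
  apply: le_trans (ln_le_sqrt _) _; first by lra.
  have : b <= (3 * q) ^+ 2.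
    rewrite exprMn skk /b; have -> : 3 ^+ 2 * k%:R = 3 * (3 * k%:R) :> R by ring.
    rewrite ler_pM2l//; apply: le_trans (_ : k.+1%:R <= _).
      by apply/ltW/ln_sublinear.
    by rewrite -natr1; lra.
  move=> /ler_wsqrtr; rewrite sqrtr_sqr ger0_norm; lra.
have -> : b * ln b - a * ln a = (b - a) * ln b + a * (ln b - ln a) by ring.
apply: le_trans (_ : (b - a) * (6 * q + 1) <= _).
  have : (b - a) * ln b <= (b - a) * (6 * q) by rewrite ler_wpM2l// subr_ge0.
  lra.
apply: le_trans (_ : 3 / k%:R * (7 * q) <= _).
  rewrite ler_pM//; lra.
have eq : 21 <= e * q.
  rewrite -(@ler_pXn2r _ 2)// ?nnegrE ?mulr_ge0//; [|lra|lra].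
  by rewrite exprMn skk.
rewrite -skk.
have -> : 3 / q ^+ 2 * (7 * q) = 21 / q by field; rewrite gt_eqF//; lra.
by rewrite ler_pdivrMr//; lra.
Qed.

(** The second bound, multiplied by [alpha] so as to be true for [alpha = 0], is
    the one that makes the imposed digits increase. *)
Lemma loglog_cube_start (alpha : R) : 0 <= alpha ->
  exists k0 : nat, [/\ (1 < k0)%N, (loglog_start <= k0)%N &
  forall k, (k0 <= k)%N ->
    loglog (k.+1 ^ 3) - loglog (k ^ 3) <= 1 /\
    alpha * (loglog (k.+1 ^ 3) - loglog (k ^ 3)) <= alpha ^+ 2].
Proof.
move=> alpha0.
have bound (e : R) : 0 < e -> exists k0 : nat, forall k, (k0 <= k)%N ->
    (loglog_start <= k)%N -> loglog (k.+1 ^ 3) - loglog (k ^ 3) <= e.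
  move=> e0; exists (Num.truncn (21 ^+ 2 / e ^+ 2)).+1 => k k0 hk.
  apply: loglog_cube_step => //.
  rewrite mulrC -ler_pdivrMr ?exprn_gt0//.
  have h0 : 0 <= 21 ^+ 2 / e ^+ 2 by rewrite divr_ge0// exprn_ge0// ltW.
  have /andP[_ /ltW h] := truncn_itv h0.
  by apply: le_trans h _; rewrite ler_nat.
have [k1 h1] := bound 1 ltr01.
have [k2 h2] : exists k2 : nat, forall k, (k2 <= k)%N -> (loglog_start <= k)%N ->
    alpha * (loglog (k.+1 ^ 3) - loglog (k ^ 3)) <= alpha ^+ 2.
  have [->|a0] := eqVneq alpha 0; first by exists 0%N => k _ _; rewrite mul0r expr0n.
  have ap : 0 < alpha by rewrite lt_neqAle eq_sym a0.
  have [k2 h2] := bound alpha ap.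
  by exists k2 => k hk hs; rewrite expr2 ler_pM2l//; exact: h2.
exists (maxn 2 (maxn loglog_start (maxn k1 k2))); split.
- by rewrite leq_max.
- by rewrite !leq_max leqnn orbT.
move=> k; rewrite !geq_max => /and4P[_ hs hk1 hk2].
by split; [exact: h1|exact: h2].
Qed.

End LogLog.

(** * Imposing large digits at the cubes *)

Section CubeRoot.

Fixpoint cube_root n : nat :=
  if n is n'.+1 then
    if ((cube_root n').+1 ^ 3 == n'.+1)%N then (cube_root n').+1 else cube_root n'
  else 0%N.

Lemma cube_root_bounds n : (cube_root n ^ 3 <= n < (cube_root n).+1 ^ 3)%N.
Proof.
elim: n => [|n /andP[IH1 IH2]]; first by rewrite exp0n.
rewrite [cube_root n.+1]/=; case: ifP => [/eqP e|/negbT e].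
  apply/andP; split; first by rewrite e.
  by rewrite -e (@ltn_exp2r _ _ 3) ?ltnSn.
by rewrite (leq_trans IH1)// ltn_neqAle eq_sym e IH2.
Qed.

Lemma cube_root_def n k : (k ^ 3 <= n < k.+1 ^ 3)%N -> cube_root n = k.
Proof.
move=> /andP[h1 h2]; have /andP[h3 h4] := cube_root_bounds n.
have := leq_ltn_trans h3 h2; have := leq_ltn_trans h1 h4.
by rewrite !ltn_exp2r// !ltnS => a b; apply/eqP; rewrite eqn_leq a b.
Qed.

Lemma cube_root_cube k : cube_root (k ^ 3) = k.
Proof. by apply: cube_root_def; rewrite leqnn /= ltn_exp2r// ltnSn. Qed.

Lemma cube_root_homo n p : (n <= p)%N -> (cube_root n <= cube_root p)%N.
Proof.
move=> np; have /andP[h1 _] := cube_root_bounds n.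
have /andP[_ h4] := cube_root_bounds p.
by have := leq_ltn_trans (leq_trans h1 np) h4; rewrite ltn_exp2r.
Qed.

Lemma leq_cube k : (k <= k ^ 3)%N.
Proof. by case: k => // k; rewrite -{1}[k.+1]expn1 leq_pexp2l. Qed.

Lemma cube_succ k : (k.+1 ^ 3 = k ^ 3 + 3 * (k ^ 2 + k) + 1)%N.
Proof. by rewrite -addn1; ring. Qed.

(** The left-hand side is a quadratic polynomial in [k] with coefficient sum
    [N = 5 * j + 2]: it is at most [k ^ 3] if [N <= k], and at most [N ^ 3] if
    not. *)
Lemma quadratic_le_cube j k :
  (j * (2 * k ^ 2 + k.+2) + 2 * k <= (5 * j + 2) ^ 3 + k ^ 3)%N.
Proof.
case: (posnP k) => [->|k_gt0].
  apply: leq_trans (leq_addr _ _); apply: leq_trans (leq_cube _).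
  by rewrite exp0n// !muln0; lia.
have kk : (k <= k ^ 2)%N by rewrite -{1}[k]expn1 leq_pexp2l.
apply: leq_trans (_ : (5 * j + 2) * k ^ 2 <= _)%N.
  have -> : ((5 * j + 2) * k ^ 2 = j * (5 * k ^ 2) + 2 * k ^ 2)%N by ring.
  by apply: leq_add; rewrite leq_mul2l; apply/orP; right; lia.
set N := (5 * j + 2)%N; have [kN|Nk] := leqP N k.
  by apply: leq_trans (leq_addl _ _); rewrite [(k ^ 3)%N]expnS leq_mul2r kN orbT.
apply: leq_trans (leq_addr _ _); rewrite [(N ^ 3)%N]expnS leq_mul2l.
by rewrite leq_exp2r// ltnW ?orbT.
Qed.

Lemma cube_root_add2 n : (cube_root n.+2 <= (cube_root n).+1)%N.
Proof.
have /andP[h1 _] := cube_root_bounds n.+2.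
have /andP[_ h4] := cube_root_bounds n.
have : (n.+2 < (cube_root n).+2 ^ 3)%N by rewrite (cube_succ (cube_root n).+1); lia.
by move=> /(leq_ltn_trans h1); rewrite ltn_exp2r.
Qed.

End CubeRoot.

Section Insertion.
Variables (R : realType) (alpha : R) (m M k0 : nat).
Hypotheses (alpha_ge0 : 0 <= alpha) (k0_large : (loglog_start R <= k0)%N).
Implicit Types (c : nat -> nat) (n k : nat).

(** Digits are numbered from 0 here, so that [n.+1] is the usual number of the
    digit imposed and [S] is the sum of the digits before it.  The maximum with
    [M] lets an imposed digit dominate the free ones, also for [alpha = 0]. *)
Definition rule n (S : nat) : option nat :=
  if (cube_root n.+1 ^ 3 == n.+1)%N && (k0 <= cube_root n.+1)%N
  then Some (maxn M (Num.truncn (alpha * S%:R / loglog R n.+1)).+1)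
  else None.

Definition follows c : Prop := forall n,
  if rule n (\sum_(i < n) c i) is Some d then c n = d else (m <= c n <= M)%N.

Lemma rule_ge n S d : rule n S = Some d -> (M <= d)%N.
Proof. by rewrite /rule; case: ifP => // _ [<-]; rewrite leq_maxl. Qed.

Lemma loglog_start_le n : (k0 <= cube_root n)%N -> (loglog_start R <= n)%N.
Proof.
move=> h; apply: leq_trans k0_large _; apply: leq_trans h _.
have /andP[h1 _] := cube_root_bounds n; apply: leq_trans h1.
exact: leq_cube.
Qed.

(** An imposed digit multiplies one plus the sum of the digits by at most this. *)
Definition jump : nat := (Num.truncn alpha).+1 + M.+2.

Lemma rule_le n S d : rule n S = Some d -> (d + S.+1 <= jump * S.+1)%N.
Proof.
rewrite /rule; case: ifP => // /andP[_ hk] [<-].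
have g1 := loglog_ge1 (loglog_start_le hk).
have /andP[_ a1] := truncn_itv alpha_ge0.
suff : (Num.truncn (alpha * S%:R / loglog R n.+1) <= (Num.truncn alpha).+1 * S)%N.
  rewrite /jump; lia.
rewrite truncn_le_nat; apply: le_lt_trans (_ : ((Num.truncn alpha).+1 * S)%:R < _).
  rewrite ler_pdivrMr; last by lra.
  apply: le_trans (_ : alpha * S%:R <= _).
    by [].
  rewrite natrM; apply: le_trans (_ : (Num.truncn alpha).+1%:R * S%:R <= _).
    by rewrite ler_wpM2r// ltW.
  by rewrite ler_peMr// mulr_ge0.
by rewrite ltr_nat.
Qed.

(** Up to the [k]-th cube the digits sum to less than [growth ^ k]: [jump] pays for
    the digit imposed at the cube, [(6 * M).+1] for the free digits since the
    preceding cube, and the summand [4] makes the powers of [growth] dominate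
    quadratic polynomials. *)
Definition growth : nat := jump * (6 * M).+1 + 4.

Lemma quad_le_growth k : (k ^ 2 + k <= 2 * growth ^ k)%N.
Proof.
apply: leq_trans (_ : 2 * 4 ^ k <= _)%N.
  elim: k => // j IHj; have := ltn_expl j (isT : 1 < 4)%N.
  rewrite [(4 ^ _.+1)%N]expnS -addn1 sqrnD; lia.
by rewrite leq_mul2l /=; case: k => // j; rewrite leq_exp2r// /growth; lia.
Qed.

Lemma follows_growth c n : follows c ->
  ((\sum_(i < n) c i).+1 <=
   growth ^ cube_root n + M * (n - cube_root n ^ 3))%N.
Proof.
move=> fc; elim: n => [|n IH]; first by rewrite big_ord0.
have steple : ((\sum_(i < n.+1) c i).+1 <= jump * (\sum_(i < n) c i).+1)%N.
  rewrite big_ord_recr /=; have := fc n.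
  case e : (rule _ _) => [d|]; first by move=> ->; rewrite -addSn addnC (rule_le e).
  move=> /andP[_ cM]; apply: leq_trans (_ : M.+2 * (\sum_(i < n) c i).+1 <= _)%N.
    move: (\sum_(i < n) c i)%N (c n) cM => S x xM.
    rewrite mulSn mulnS; move: (M.+1 * S)%N => X; lia.
  by rewrite leq_mul2r leq_addl orbT.
have /andP[h1 h2] := cube_root_bounds n.
have ES : (\sum_(i < n.+1) c i = \sum_(i < n) c i + c n)%N by rewrite big_ord_recr.
have free : ((cube_root n).+1 ^ 3 == n.+1)%N = false -> (c n <= M)%N.
  move=> ne; have := fc n; rewrite /rule [cube_root n.+1]/= ne.
  by rewrite (_ : _ ^ 3 == _ = false)%N /=; [case/andP|apply/negbTE; lia].
move: steple IH free; rewrite ES [cube_root n.+1]/=.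
set k := cube_root n in h1 h2 *; set S := (\sum_(i < n) c i)%N.
case: eqP => [e|ne] steple IH free.
  have E : (n - k ^ 3 = 3 * (k ^ 2 + k))%N by move: e; rewrite cube_succ; lia.
  rewrite e subnn muln0 addn0; apply: leq_trans steple _.
  have k2 := quad_le_growth k.
  apply: leq_trans (_ : jump * (6 * M).+1 * growth ^ k <= _)%N; last first.
    by rewrite expnS leq_mul2r /growth leq_addr orbT.
  rewrite -mulnA leq_mul2l; apply/orP; right; apply: leq_trans IH _.
  have -> : ((6 * M).+1 * growth ^ k = growth ^ k + M * (3 * (2 * growth ^ k)))%N.
    by rewrite mulSn; ring.
  by rewrite E leq_add2l !leq_mul2l k2 !orbT.
by have := free erefl; rewrite subSn// mulnS; lia.
Qed.

Lemma follows_sum_le c n : follows c ->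
  ((\sum_(i < n) c i).+1 <= growth ^ (cube_root n).+1)%N.
Proof.
move=> fc; apply: leq_trans (follows_growth n fc) _.
have /andP[h1 h2] := cube_root_bounds n.
set k := cube_root n in h1 h2 *.
apply: leq_trans (_ : growth ^ k + M * (3 * (2 * growth ^ k)) <= _)%N.
  rewrite leq_add2l leq_mul2l; apply/orP; right.
  apply: leq_trans (_ : 3 * (k ^ 2 + k) <= _)%N.
    by move: h2; rewrite cube_succ; lia.
  by rewrite leq_mul2l quad_le_growth orbT.
apply: leq_trans (_ : (6 * M).+1 * growth ^ k <= _)%N.
  by apply: eq_leq; rewrite [RHS]mulSn; ring.
rewrite expnS leq_mul2r /growth; apply/orP; right.
apply: leq_trans (leq_addr _ _); rewrite leq_pmull// /jump; lia.
Qed.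

Lemma growth_ge1 : 1 <= growth%:R :> R.
Proof. by rewrite ler1n /growth; lia. Qed.

(** The digit imposed at the [j]-th cube is less than [growth ^ j], and
    [2 * (1 + ... + k) <= 2 * k ^ 2]. *)
Lemma follows_weight c n (K : R) : 1 <= K -> follows c ->
  weight rule K c n * K ^+ n
  <= growth%:R ^+ (2 * cube_root n ^ 2) * K ^+ cube_root n.
Proof.
move=> K1 fc; elim: n => [|n IH]; first by rewrite /= exp0n// muln0 !mulr1.
have G1 := growth_ge1.
have G0 : 0 <= growth%:R :> R by [].
have K0 : 0 <= K by lra.
rewrite [weight _ _ _ _]/= exprSr.
set w := (if _ is Some d then _ else _).
have -> : weight rule K c n * w * (K ^+ n * K) = (weight rule K c n * K ^+ n) * (w * K).
  by ring.
have kn := cube_root_homo (leqnSn n).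
have w0 : 0 <= w.
  rewrite /w; case: (rule _ _) => [d|]; first by rewrite exprn_ge0.
  by rewrite invr_ge0; lra.
apply: le_trans (ler_wpM2r _ IH) _; first by rewrite mulr_ge0//; lra.
have fS := follows_growth n.+1 fc; have fcn := fc n.
rewrite /w; case e : (rule _ _) fcn => [d|] fcn; last first.
  rewrite mulVf ?mulr1; last by rewrite gt_eqF//; lra.
  have k2 : (2 * cube_root n ^ 2 <= 2 * cube_root n.+1 ^ 2)%N.
    by rewrite leq_mul2l /= leq_exp2r.
  apply: ler_pM; rewrite ?exprn_ge0//; exact: ler_weXn2l.
have eq : (cube_root n.+1 ^ 3)%N = n.+1.
  by move: e; rewrite /rule; case: ifP => // /andP[/eqP].
have kE : cube_root n.+1 = (cube_root n).+1.
  rewrite [cube_root n.+1]/=; case: ifP => // ne.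
  have /andP[h1 _] := cube_root_bounds n.
  by move: eq; rewrite [cube_root n.+1]/= ne; lia.
have d1 : (d.+1 <= growth ^ (cube_root n).+1)%N.
  move: fS; rewrite eq subnn muln0 addn0 kE; apply: leq_trans.
  by rewrite ltnS big_ord_recr /= fcn leq_addl.
rewrite kE; set k := cube_root n; set G := growth%:R in G0 G1 *.
have d2 : d.+1%:R ^+ 2 <= G ^+ (2 * k.+1) :> R.
  rewrite mulnC exprM ler_pXn2r ?nnegrE// ?exprn_ge0//.
  by rewrite /G -natrX ler_nat.
have -> : G ^+ (2 * k ^ 2) * K ^+ k * (d.+1%:R ^+ 2 * K) =
   (G ^+ (2 * k ^ 2) * d.+1%:R ^+ 2) * K ^+ k.+1
  by rewrite [K ^+ k.+1]exprS; move: (G ^+ _) (K ^+ k) => x y; ring.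
rewrite ler_wpM2r ?exprn_ge0//.
apply: le_trans (_ : G ^+ (2 * k ^ 2) * G ^+ (2 * k.+1) <= _).
  by rewrite ler_wpM2l// exprn_ge0.
rewrite -exprD ler_weXn2l// -mulnDr leq_mul2l /= -(addn1 k) sqrnD; lia.
Qed.

(** After [n] digits, with [k] the integer part of the cube root of [n], the loss
    is exponential in [k ^ 2] and the gain is exponential in [n >= k ^ 3].  The
    sum of [n.+2] digits stands for the digit after a first difference at [n],
    on which the distance of points depends.  The spare factor [K ^+ k] yields
    convergence to 0 and not just boundedness, which is used to see that
    different reals have different codes. *)
Lemma follows_weight_sum (K : R) : 1 < K -> exists E : nat,
  forall c n, follows c ->
  weight rule K c n * (\sum_(i < n.+2) c i).+1%:R * K ^+ cube_root n <= K ^+ E.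
Proof.
move=> K1; have G1 := growth_ge1.
have G0 : 0 <= growth%:R :> R by [].
have K0 : 0 <= K by lra.
(* Once [growth] is bounded by [K ^+ j], everything is a power of [K]. *)
have [j Gj] : exists j, growth%:R <= K ^+ j.
  pose j := (Num.truncn (growth%:R / (K - 1))).+1; exists j.
  have h0 : 0 <= growth%:R / (K - 1) by rewrite divr_ge0//; lra.
  have /andP[_ /ltW] := truncn_itv h0; rewrite -/j ler_pdivrMr ?subr_gt0// => h.
  by apply: le_trans h _; exact: linear_le_exprn.
exists ((5 * j + 2) ^ 3)%N => c n fc.
have /andP[h1 _] := cube_root_bounds n.
have hw := follows_weight n (ltW K1) fc.
have hs : ((\sum_(i < n.+2) c i).+1%:R : R) <= growth%:R ^+ (cube_root n).+2.
  rewrite -natrX ler_nat; apply: leq_trans (follows_sum_le n.+2 fc) _.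
  by rewrite leq_pexp2l ?cube_root_add2// ?ltnS ?cube_root_add2// /growth; lia.
set k := cube_root n in h1 hw hs *; set W := weight _ _ _ _ in hw *.
have Kn : 0 < K ^+ n by rewrite exprn_gt0//; lra.
rewrite -(ler_pM2r Kn).
have -> : W * (\sum_(i < n.+2) c i).+1%:R * K ^+ k * K ^+ n =
  (W * K ^+ n) * (\sum_(i < n.+2) c i).+1%:R * K ^+ k by ring.
have W0 : 0 <= W by apply: weight_ge0; lra.
apply: le_trans (_ : (growth%:R ^+ (2 * k ^ 2) * K ^+ k) * growth%:R ^+ k.+2 * K ^+ k <= _).
  rewrite ler_wpM2r ?exprn_ge0//.
  by apply: ler_pM => //; rewrite mulr_ge0// ltW.
have -> : growth%:R ^+ (2 * k ^ 2) * K ^+ k * growth%:R ^+ k.+2 * K ^+ k =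
  growth%:R ^+ (2 * k ^ 2 + k.+2) * K ^+ (2 * k) :> R.
  rewrite exprD (mul2n k) -addnn (exprD K).
  by move: (growth%:R ^+ _) (growth%:R ^+ _) (K ^+ k) => x y z; ring.
apply: le_trans (_ : (K ^+ j) ^+ (2 * k ^ 2 + k.+2) * K ^+ (2 * k) <= _).
  rewrite ler_wpM2r ?exprn_ge0//.
  by rewrite lerXn2r ?nnegrE// exprn_ge0.
rewrite -exprM -!exprD ler_weXn2l//; first exact: ltW.
apply: leq_trans (quadratic_le_cube j k) _.
by rewrite leq_add2l.
Qed.

End Insertion.

(** * The limit of the ratio *)

Section RatioLimit.
Variables (R : realType) (alpha : R) (m M k0 : nat).
Hypotheses (alpha_ge0 : 0 <= alpha) (m_gt1 : (1 < m)%N) (m_leM : (m <= M)%N)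
  (k0_gt1 : (1 < k0)%N) (k0_large : (loglog_start R <= k0)%N).
Hypothesis loglog_slow : forall k, (k0 <= k)%N ->
  loglog R (k.+1 ^ 3) - loglog R (k ^ 3) <= 1 /\
  alpha * (loglog R (k.+1 ^ 3) - loglog R (k ^ 3)) <= alpha ^+ 2.
Variable c : nat -> nat.
Hypothesis c_follows : follows alpha m M k0 c.
Implicit Types (i n k : nat).

Definition peak k : nat := c (k ^ 3).-1.

Definition before_peak k : nat := \sum_(i < (k ^ 3).-1) c i.

Lemma k0_cube_gt0 k : (k0 <= k)%N -> (0 < k ^ 3)%N.
Proof. by move=> hk; rewrite expn_gt0 (leq_trans _ hk)//; exact: ltnW. Qed.

Lemma loglog_cube_ge1 k : (k0 <= k)%N -> 1 <= loglog R (k ^ 3).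
Proof.
move=> hk; apply: loglog_ge1; apply: (leq_trans k0_large); apply: leq_trans hk _.
exact: leq_cube.
Qed.

Lemma peakE k : (k0 <= k)%N ->
  peak k = maxn M (Num.truncn (alpha * (before_peak k)%:R / loglog R (k ^ 3))).+1.
Proof.
move=> hk; have k3 := k0_cube_gt0 hk.
have := c_follows (k ^ 3).-1; rewrite /rule prednK//.
by rewrite cube_root_cube eqxx hk.
Qed.

Lemma peak_bounds k : (k0 <= k)%N ->
  alpha * (before_peak k)%:R / loglog R (k ^ 3) <= (peak k)%:R
    <= alpha * (before_peak k)%:R / loglog R (k ^ 3) + M%:R.
Proof.
move=> hk; rewrite peakE//; have g1 := loglog_cube_ge1 hk.
set y := _ / loglog R (k ^ 3).
have y0 : 0 <= y.
  by apply: divr_ge0; [apply: mulr_ge0 => //; exact: ler0n|exact: le_trans g1].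
have /andP[y1 /ltW y2] := truncn_itv y0.
have M1 : 1 <= M%:R :> R by rewrite ler1n (leq_trans _ m_leM)// ltnW.
apply/andP; split.
  by apply: le_trans y2 _; rewrite ler_nat leq_maxr.
rewrite /maxn; case: ifP => _; last by rewrite lerDr.
by rewrite -natr1 lerD.
Qed.

Lemma follows_ge i : (m <= c i)%N.
Proof.
have := c_follows i; case e : (rule _ _ _ _ _) => [d|]; last by case/andP.
by move=> ->; exact: leq_trans m_leM (rule_ge e).
Qed.

Lemma sum_ge n : (n <= \sum_(i < n) c i)%N.
Proof.
rewrite -{1}[n]card_ord -sum1_card; apply: leq_sum => i _.
by apply: leq_trans (follows_ge i); exact: ltnW.
Qed.

Lemma sum_split k n : (0 < k ^ 3 <= n)%N ->
  (\sum_(i < n) c i = before_peak k + peak k + \sum_(k ^ 3 <= i < n) c i)%N.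
Proof.
move=> /andP[k3 kn]; rewrite -(big_mkord xpredT) (@big_cat_nat _ _ _ (k ^ 3)%N)//=.
by rewrite -{1}(prednK k3) big_nat_recr//= big_mkord.
Qed.

(** With [S] the sum before the [k]-th peak and [g], [g'] the values of [loglog] at
    the two cubes, the next sum is at least [S * (1 + alpha / g)].  The
    quotient by the normalising factor does not decrease as soon as
    [g' <= g + alpha]. *)
Lemma peak_succ k : (k0 <= k)%N -> (peak k <= peak k.+1)%N.
Proof.
move=> hk; have hk1 : (k0 <= k.+1)%N by exact: leqW.
have := peak_bounds hk; have := loglog_cube_ge1 hk; have := loglog_cube_ge1 hk1.
rewrite [peak k]peakE// [peak k.+1]peakE//.
have := loglog_slow hk; set g := loglog R (k ^ 3); set g' := loglog R (k.+1 ^ 3).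
move=> [_ gg] g'1 g1 /andP[lo _].
rewrite geq_max leq_maxl leq_max; apply/orP; right; rewrite ltnS; apply: le_truncn.
rewrite ler_pdivrMr; last by lra.
rewrite mulrAC ler_pdivlMr; last by lra.
have : (before_peak k)%:R + alpha * (before_peak k)%:R / g <= (before_peak k.+1)%:R.
  apply: le_trans (_ : (before_peak k + peak k)%:R <= _).
    by rewrite natrD lerD2l peakE.
  rewrite ler_nat /before_peak; have k3 := k0_cube_gt0 hk.
  have kk : (k ^ 3 <= (k.+1 ^ 3).-1)%N by rewrite cube_succ addn1 leq_addr.
  by rewrite [leqRHS](@sum_split k) ?k3// leq_addr.
set x := (before_peak k)%:R; set x' := (before_peak k.+1)%:R => xx.
have x0 : 0 <= x by rewrite /x.
apply: le_trans (_ : alpha * x * (g + alpha) <= _).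
  have := ler_wpM2r x0 gg; lra.
have -> : alpha * x * (g + alpha) = alpha * (x + alpha * x / g) * g.
  by field; rewrite gt_eqF//; lra.
rewrite ler_wpM2r//; first by lra.
by rewrite ler_wpM2l.
Qed.

Lemma peak_homo j k : (k0 <= j)%N -> (j <= k)%N -> (peak j <= peak k)%N.
Proof.
move=> hj /subnKC <-; elim: (k - j)%N => [|d IH]; first by rewrite addn0.
apply: leq_trans IH _; rewrite addnS; apply: peak_succ.
exact: leq_trans hj (leq_addr _ _).
Qed.

Lemma le_peak k n i : (k0 <= k)%N -> (n < k.+1 ^ 3)%N -> (i < n)%N ->
  (c i <= peak k)%N.
Proof.
move=> hk nk ni; have := c_follows i.
case e : (rule _ _ _ _ _) => [d|]; last first.
  by move=> /andP[_ cM]; apply: leq_trans cM _; rewrite peakE// leq_maxl.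
move=> _; move: e; rewrite /rule; case: ifP => // /andP[/eqP ij hj] _.
have -> : c i = peak (cube_root i.+1) by rewrite /peak ij.
apply: peak_homo => //.
have : (cube_root i.+1 ^ 3 < k.+1 ^ 3)%N by rewrite ij (leq_ltn_trans ni nk).
by rewrite ltn_exp2r.
Qed.

Lemma max_eq_peak k n : (k0 <= k)%N -> (k ^ 3 <= n < k.+1 ^ 3)%N ->
  (\max_(i < n) c i = peak k)%N.
Proof.
move=> hk /andP[kn nk]; have k3 := k0_cube_gt0 hk.
have kn' : ((k ^ 3).-1 < n)%N by rewrite prednK.
apply/eqP; rewrite eqn_leq; apply/andP; split.
  by apply/bigmax_leqP => i _; exact: le_peak nk _.
exact: (leq_bigmax (Ordinal kn')).
Qed.

Lemma after_peak_le k n : (k ^ 3 <= n < k.+1 ^ 3)%N ->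
  (\sum_(k ^ 3 <= i < n) c i <= M * (n - k ^ 3))%N.
Proof.
move=> /andP[kn nk]; rewrite mulnC -sum_nat_const_nat big_nat [leqRHS]big_nat.
apply: leq_sum => i /andP[ki ii]; have := c_follows i.
rewrite /rule (@cube_root_def i.+1 k) ?(leqW ki) ?(leq_ltn_trans ii)//.
by rewrite (_ : (_ == _) = false) /=; [case/andP|apply/negbTE; rewrite neq_ltn ltnS ki].
Qed.

(** Here [x] is the sum before the peak [D], [B] the sum after it, and [g] and
    [G] the normalising factors at the peak and at the present position. *)
Lemma ratio_estimate (g G x B D Mr k : R) : 1 <= g -> g <= G -> G <= g + 1 ->
  G <= 36 * k ^+ 2 -> 1 <= k -> k ^+ 3 <= 2 * x -> 0 <= B -> 0 <= Mr ->
  B <= 6 * Mr * k ^+ 2 ->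
  alpha * x / g <= D <= alpha * x / g + Mr ->
  `|alpha - D * G / (x + B)| <= alpha / g + (72 + 12 * alpha) * Mr / k.
Proof.
move=> g1 gG Gg Gk k1 kx B0 M0 BM /andP[D1 D2].
have k3 : 1 <= k ^+ 3 by rewrite exprn_ege1.
have x0 : 0 < x by lra.
have D0 : 0 <= D by apply: le_trans D1; rewrite divr_ge0 ?mulr_ge0//; lra.
have k2x : k ^+ 2 / x <= 2 / k.
  rewrite ler_pdivrMr// mulrAC ler_pdivlMr; last by lra.
  by rewrite -exprSr.
have up : D * G / (x + B) <= alpha + alpha / g + 72 * (Mr / k).
  apply: le_trans (_ : D * G / x <= _).
    apply: ler_wpM2l; first by apply: mulr_ge0 => //; lra.
    by rewrite lef_pV2 ?posrE; lra.
  apply: le_trans (_ : (alpha * x / g + Mr) * G / x <= _).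
    by rewrite ler_wpM2r ?invr_ge0 ?ler_wpM2r//; lra.
  have -> : (alpha * x / g + Mr) * G / x = alpha * G / g + Mr * (G / x).
    by field; rewrite !gt_eqF//; lra.
  rewrite lerD//.
    rewrite ler_pdivrMr; last by lra.
    rewrite mulrDl divfK; last by rewrite gt_eqF//; lra.
    by have := ler_wpM2l alpha_ge0 Gg; lra.
  have -> : 72 * (Mr / k) = Mr * (36 * (2 / k)) by ring.
  rewrite ler_wpM2l//; apply: le_trans (_ : 36 * (k ^+ 2 / x) <= _); last first.
    by rewrite ler_pM2l.
  by rewrite mulrA ler_wpM2r// invr_ge0 ltW.
have lo : alpha - 12 * alpha * (Mr / k) <= D * G / (x + B).
  apply: le_trans (_ : alpha * x / (x + B) <= _); last first.
    rewrite ler_wpM2r ?invr_ge0//; first by lra.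
    apply: le_trans (_ : alpha * x / g * g <= _); first by rewrite divfK// gt_eqF//; lra.
    by apply: ler_pM => //; rewrite ?divr_ge0 ?mulr_ge0//; lra.
  have -> : alpha * x / (x + B) = alpha - alpha * (B / (x + B)).
    by field; rewrite gt_eqF//; lra.
  rewrite lerD2l lerN2 (mulrC 12) -mulrA ler_wpM2l//.
  apply: le_trans (_ : 6 * Mr * k ^+ 2 / x <= _).
    apply: ler_pM => //; first by rewrite invr_ge0; lra.
    by rewrite lef_pV2 ?posrE; lra.
  have -> : 12 * (Mr / k) = 6 * Mr * (2 / k) by ring.
  by rewrite -mulrA ler_wpM2l//; lra.
have Mk : 0 <= Mr / k by rewrite divr_ge0//; lra.
have aMk : 0 <= alpha * (Mr / k) by rewrite mulr_ge0.
have ag : 0 <= alpha / g by rewrite divr_ge0//; lra.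
rewrite -mulrA ler_norml; lra.
Qed.

Lemma ratio_near k n : (k0 <= k)%N -> (k ^ 3 <= n < k.+1 ^ 3)%N ->
  `|alpha - (\max_(i < n) c i)%:R * ln n%:R * ln (ln n%:R) /
      ((\sum_(i < n) c i)%:R - (\max_(i < n) c i)%:R)|
  <= alpha / loglog R (k ^ 3) + (72 + 12 * alpha) * M%:R / k%:R.
Proof.
move=> hk kn; have /andP[kn1 kn2] := kn; have k3 := k0_cube_gt0 hk.
rewrite (max_eq_peak hk kn) (@sum_split k) ?k3//.
set L : R := (peak k)%:R.
have -> : (before_peak k + peak k + \sum_(k ^ 3 <= i < n) c i)%:R - L =
   (before_peak k)%:R + (\sum_(k ^ 3 <= i < n) c i)%:R by rewrite !natrD /L; ring.
rewrite -[L * _ * _]mulrA -/(loglog R n).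
have hk1 : (k0 <= k.+1)%N by exact: leqW.
have g1 := loglog_cube_ge1 hk.
have start : (loglog_start R <= k ^ 3)%N.
  apply: (leq_trans k0_large); apply: leq_trans hk _.
  exact: leq_cube.
have gG : loglog R (k ^ 3) <= loglog R n by exact: loglog_homo.
have Gg : loglog R n <= loglog R (k.+1 ^ 3).
  by apply: loglog_homo (ltnW kn2); exact: leq_trans start kn1.
have [gg _] := loglog_slow hk.
have k1 : (1 < k)%N by exact: leq_trans hk.
have k1R : 2 <= k%:R :> R by rewrite ler_nat.
apply: ratio_estimate => //.
- by apply: le_trans Gg _; lra.
- apply: le_trans Gg _; apply: le_trans (loglog_cube_le _) _.
    by apply: leq_trans start _; rewrite leq_exp2r.
  by rewrite -natr1; nra.
- lra.
- have : (k ^ 3 <= 2 * before_peak k)%N.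
    have := sum_ge (k ^ 3).-1; rewrite -/(before_peak k).
    have : (2 ^ 3 <= k ^ 3)%N by rewrite leq_exp2r.
    lia.
  by rewrite -(ler_nat R) natrM natrX.
- have : (\sum_(k ^ 3 <= i < n) c i <= 6 * M * k ^ 2)%N.
    apply: leq_trans (after_peak_le kn) _; rewrite (mulnC 6) -mulnA leq_mul2l.
    apply/orP; right; move: kn2; rewrite cube_succ.
    have : (k <= k ^ 2)%N by rewrite -{1}[k]expn1 leq_pexp2l// ltnW.
    lia.
  by rewrite -(ler_nat R) natrM natrX natrM.
- exact: peak_bounds.
Qed.

Lemma follows_ratio_cvg :
  (\max_(i < n) c i)%:R * ln n%:R * ln (ln n%:R) /
    ((\sum_(i < n) c i)%:R - (\max_(i < n) c i)%:R) @[n --> \oo] --> alpha.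
Proof.
apply/cvgrPdist_le => /= e e0.
pose k1 := (Num.truncn (expR (2 * alpha / e))).+1.
pose k2 := (Num.truncn ((72 + 12 * alpha) * M%:R * 2 / e)).+1.
pose kk := maxn k0 (maxn k1 k2).
near=> n.
have nk : (kk ^ 3 <= n)%N by near: n; exact: nbhs_infty_ge.
have kn := cube_root_bounds n; have /andP[_ kn2] := kn.
set k := cube_root n in kn kn2.
have : (kk <= k)%N by have := leq_ltn_trans nk kn2; rewrite ltn_exp2r.
rewrite !geq_max => /and3P[hk hk1 hk2].
apply: le_trans (ratio_near hk kn) _.
have start : (loglog_start R <= k ^ 3)%N.
  apply: (leq_trans k0_large); apply: leq_trans hk _.
  exact: leq_cube.
have g1 := loglog_cube_ge1 hk.
have kp : 0 < k%:R :> R by rewrite ltr0n (leq_trans _ hk)// ltnW.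
have -> : e = e / 2 + e / 2 by field.
apply: lerD.
  rewrite ler_pdivrMr; last by lra.
  have : 2 * alpha / e <= loglog R (k ^ 3).
    apply: le_trans (loglog_ge_ln start).
    rewrite -ler_expR lnK; last by rewrite posrE ltr0n k0_cube_gt0.
    have /andP[_ /ltW h] := truncn_itv (expR_ge0 (2 * alpha / e)).
    apply: le_trans h _; rewrite ler_nat; apply: leq_trans hk1 _.
    exact: leq_cube.
  rewrite ler_pdivrMr//; lra.
rewrite ler_pdivrMr//.
have a0 := alpha_ge0.
have h0 : 0 <= (72 + 12 * alpha) * M%:R * 2 / e.
  by rewrite divr_ge0 ?mulr_ge0//; lra.
have /andP[_ /ltW h] := truncn_itv h0.
have : (72 + 12 * alpha) * M%:R * 2 / e <= k%:R.
  by apply: le_trans h _; rewrite ler_nat.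
rewrite ler_pdivrMr//; lra.
Unshelve. all: end_near. Qed.

End RatioLimit.

(** * Hausdorff dimension of the set of coded points *)

Section DigitStatistics.
Variables (R : realType) (theta x : R) (c : nat -> nat).
Hypothesis digitE : forall k, digit theta k.+1 x = (c k)%:R%:E.

Lemma fine_digit_sum n : fine (digit_sum theta n x) = (\sum_(i < n) c i)%:R.
Proof.
rewrite /digit_sum big_add1 /= big_mkord natr_sum.
by rewrite (eq_bigr (fun i : 'I_n => (c i)%:R%:E)) ?sumEFin// => i _; rewrite digitE.
Qed.

Lemma fine_digit_max n : fine (digit_max theta n x) = (\max_(i < n) c i)%:R.
Proof.
rewrite /digit_max big_add1 /= big_mkord.
case: n => [|n]; first by rewrite !big_ord0.
suff -> : \big[maxe/-oo%E]_(i < n.+1) digit theta i.+1 x =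
  (\max_(i < n.+1) c i)%:R%:E by [].
elim: n => [|n IH].
  by rewrite !big_ord_recr /= !big_ord0 digitE maxNye max0n.
rewrite big_ord_recr IH [in RHS]big_ord_recr /= digitE -EFin_max.
congr EFin; rewrite /maxn; case: ltnP => h; first by rewrite max_r// ler_nat ltnW.
by rewrite max_l// ler_nat.
Qed.

Lemma trimmed_ratioE n : trimmed_ratio theta x n =
  (\max_(i < n) c i)%:R * ln n%:R * ln (ln n%:R) /
    ((\sum_(i < n) c i)%:R - (\max_(i < n) c i)%:R).
Proof. by rewrite /trimmed_ratio fine_digit_sum fine_digit_max. Qed.

End DigitStatistics.

Lemma countable_rational (R : realType) : countable (@rational R).
Proof. exact: sub_countable (card_image_le _ _) (countableP _). Qed.

(** As [M] grows the free mass tends to 1 uniformly in the offset, while the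
    power on the left is less than 1. *)
Lemma free_mass_slack (R : realType) (m : nat) (s : R) : (1 < m)%N -> s < 1 ->
  exists (M : nat) (K : R), [/\ (m <= M)%N, 1 < K &
  forall tau, 0 <= tau <= 1 -> 2^-1 `^ (1 - s) * K <= free_mass m M tau].
Proof.
move=> m1 s1; set h := 2^-1 `^ (1 - s).
have h0 : 0 < h by rewrite powR_gt0// invr_gt0.
have h1 : h < 1.
  apply: (@lt_le_trans _ _ (1 `^ (1 - s))); last by rewrite powR1.
  by apply: gt0_ltr_powR; rewrite ?nnegrE//; lra.
pose M := (m + (Num.truncn (2 * (m%:R + 1) / (1 - h))).+1)%N.
have m0 : 0 < m%:R :> R by rewrite ltr0n ltnW.
exists M, ((1 + h^-1) / 2); split; first by rewrite /M leq_addr.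
  have : 1 < h^-1 by rewrite -[ltLHS]invr1 ltf_pV2 ?posrE.
  lra.
move=> tau /andP[t0 t1].
have -> : h * ((1 + h^-1) / 2) = (1 + h) / 2 by field; rewrite gt_eqF.
have q0 : 0 <= 2 * (m%:R + 1) / (1 - h) by rewrite divr_ge0//; lra.
have /andP[_ /ltW q1] := truncn_itv q0.
have MM : 2 * (m%:R + 1) <= M.+1%:R * (1 - h).
  rewrite -ler_pdivrMr; last by lra.
  by apply: le_trans q1 _; rewrite ler_nat /M; lia.
have M0 : 0 < M.+1%:R + tau by rewrite ltr_wpDr.
rewrite /free_mass.
have : (m%:R + tau) / (M.+1%:R + tau) <= (1 - h) / 2.
  rewrite ler_pdivrMr//.
  have : 0 <= tau * (1 - h) by rewrite mulr_ge0//; lra.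
  lra.
lra.
Qed.

Section HoelderCoding.
Variables (R : realType) (theta alpha s K : R) (m M k0 : nat).
Hypotheses (theta_gt0 : 0 < theta) (m_gt1 : (1 < m)%N)
  (theta_sq : theta ^+ 2 * m%:R = 1) (alpha_ge0 : 0 <= alpha)
  (s_itv : 0 <= s < 1) (K_gt1 : 1 < K) (m_leM : (m <= M)%N)
  (k0_gt1 : (1 < k0)%N) (k0_large : (loglog_start R <= k0)%N)
  (slack : forall tau, 0 <= tau <= 1 -> 2^-1 `^ (1 - s) * K <= free_mass m M tau).
Implicit Types t u : R.

Let f := rule alpha M k0.

Let f_ge n S d : f n S = Some d -> (m <= d)%N.
Proof. by move=> e; apply: leq_trans m_leM (rule_ge e). Qed.

Definition digits t := coding m M f t.

Definition point t := tail theta (digits t) 0.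

Lemma digits_ge t i : 0 <= t < 1 -> (m <= digits t i)%N.
Proof. by move=> t01; exact: coding_ge. Qed.

Lemma digits_follow t : 0 <= t < 1 -> follows alpha m M k0 (digits t).
Proof.
move=> t01 n; rewrite -/f; case e : (f _ _) => [d|].
  by have [] := coding_forced e.
by rewrite digits_ge//= (coding_free_le m_gt1 m_leM f_ge).
Qed.

Lemma digits_dist : exists E : nat, forall t u n, 0 <= t < 1 -> 0 <= u < 1 ->
  (forall i, (i < n)%N -> digits t i = digits u i) ->
  `|t - u| * (\sum_(i < n.+2) digits t i).+1%:R * K ^+ cube_root n
    <= K ^+ E * cyl_length R m (digits t) n `^ s.
Proof.
have [E hE] := follows_weight_sum m M alpha_ge0 k0_large K_gt1.
have K0 : 0 < K := lt_trans ltr01 K_gt1.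
exists E => t u n t01 u01 tu.
have := hE _ n (digits_follow t01).
have := coding_dist m_gt1 m_leM f_ge K0 s_itv slack t01 u01 tu.
rewrite -/(digits t); set W := weight _ _ _ _; set L := _ `^ s.
set S := _.+1%:R; set Kn := K ^+ cube_root n => d1 d2.
have L0 : 0 <= L by exact: powR_ge0.
have W0 : 0 <= W by exact: weight_ge0.
have r1 : `|residue m M f t n - residue m M f u n| <= 1.
  have /andP[a0 a1] := residue_bounds m_gt1 m_leM f_ge n t01.
  have /andP[b0 b1] := residue_bounds m_gt1 m_leM f_ge n u01.
  by rewrite ler_norml; lra.
have {}d1 : `|t - u| <= W * L.
  by apply: le_trans d1 _; rewrite ler_piMr// mulr_ge0.
have S0 : 0 <= S by exact: ler0n.
have Kn0 : 0 <= Kn by rewrite exprn_ge0// ltW.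
apply: le_trans (_ : W * L * S * Kn <= _); first by rewrite !ler_wpM2r.
have -> : W * L * S * Kn = (W * S * Kn) * L by ring.
by rewrite ler_wpM2r.
Qed.

(** Codes that agree forever would force [|t - u| * K ^+ k] to be bounded.  At the
    first difference the digit is free, as an imposed one depends only on the
    preceding digits. *)
Lemma digits_first_diff t u : 0 <= t < 1 -> 0 <= u < 1 -> t != u ->
  exists n, [/\ forall i, (i < n)%N -> digits t i = digits u i,
    digits t n <> digits u n, (digits t n <= M)%N & (digits u n <= M)%N].
Proof.
move=> t01 u01 tu.
have ex_diff : exists n, digits t n != digits u n.
  apply: contrapT => no.
  have same i : digits t i = digits u i.
    by apply/eqP; apply: contrapT => /negP h; apply: no; exists i.
  have [E hE] := digits_dist.
  have tu0 : 0 < `|t - u| by rewrite normr_gt0 subr_eq0.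
  have bound k : `|t - u| * K ^+ k <= K ^+ E.
    have := hE t u (k ^ 3)%N t01 u01 (fun i _ => same i).
    rewrite cube_root_cube => h.
    have L1 : cyl_length R m (digits t) (k ^ 3) `^ s <= 1.
      have ma := fun i => digits_ge i t01.
      have L1 := cyl_length_le1 R m_gt1 (k ^ 3) ma.
      have L0 := cyl_length_gt0 R m_gt1 (k ^ 3) ma.
      have /andP[s0 _] := s_itv.
      apply: (@le_trans _ _ (1 `^ s)); last by rewrite powR1.
      by apply: ge0_ler_powR => //; rewrite nnegrE// ltW.
    have Kp j : 0 <= K ^+ j by rewrite exprn_ge0// (le_trans ler01)// ltW.
    apply: le_trans (le_trans h _); last by rewrite ler_piMr.
    by rewrite ler_wpM2r// ler_peMr// ler1n.
  pose k := (Num.truncn (K ^+ E / `|t - u| / (K - 1))).+1.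
  have K1 := K_gt1.
  have h0 : 0 <= K ^+ E / `|t - u| / (K - 1).
    by rewrite !divr_ge0// ?exprn_ge0//; lra.
  have /andP[_] := truncn_itv h0.
  rewrite -/k ltr_pdivrMr ?subr_gt0// ltr_pdivrMr// => h1.
  have h2 := linear_le_exprn k K1; have := bound k.
  have := ler_wpM2l (ltW tu0) h2; lra.
have [n /eqP dn min] := ex_minnP ex_diff.
have same i : (i < n)%N -> digits t i = digits u i.
  by move=> ni; apply/eqP; apply: contraTT ni => /min; rewrite -leqNgt.
have eS : (\sum_(i < n) digits u i = \sum_(i < n) digits t i)%N.
  by apply: eq_bigr => i _; rewrite same.
exists n; case e : (f n (\sum_(i < n) digits t i)) => [d|].
  have [ed _] := coding_forced e.
  have [ed' _] := coding_forced (etrans (congr1 (f n) eS) e).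
  by case: dn; rewrite /digits ed ed'.
split=> //; first exact: (coding_free_le m_gt1 m_leM f_ge).
by apply: (coding_free_le m_gt1 m_leM f_ge) => //; rewrite -/(digits u) eS.
Qed.

Lemma point_dist t u n : 0 <= t < 1 -> 0 <= u < 1 ->
  (forall i, (i < n)%N -> digits t i = digits u i) ->
  digits t n <> digits u n -> (digits t n <= M)%N -> (digits u n <= M)%N ->
  cyl_length R m (digits t) n <= 4 * M.+1%:R ^+ 2 *
   ((\sum_(i < n.+2) digits t i).+1 + (\sum_(i < n.+2) digits u i).+1)%:R *
   `|point t - point u|.
Proof.
move=> t01 u01 same dn dt du.
have last_le v : (digits v n.+1 < (\sum_(i < n.+2) digits v i).+1)%N.
  by rewrite ltnS [leqRHS]big_ord_recr leq_addl.
apply: (tail_dist_ge theta_gt0 m_gt1 theta_sq) => //.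
- by move=> i; exact: digits_ge.
- by move=> i; exact: digits_ge.
- exact: leq_trans (last_le t) (leq_addr _ _).
- exact: leq_trans (last_le u) (leq_addl _ _).
Qed.

Lemma point_inj t u : 0 <= t < 1 -> 0 <= u < 1 -> point t = point u -> t = u.
Proof.
move=> t01 u01 e; apply/eqP; apply: contraT => tu.
have [n [same dn dt du]] := digits_first_diff t01 u01 tu.
have := point_dist t01 u01 same dn dt du; rewrite e subrr normr0 mulr0.
by rewrite leNgt (cyl_length_gt0 R m_gt1)// => i; exact: digits_ge.
Qed.

Lemma point_hoelder : exists2 C : R, 0 < C & forall t u, 0 <= t < 1 -> 0 <= u < 1 ->
  `|t - u| <= C * `|point t - point u| `^ s.
Proof.
have [E hE] := digits_dist.
have K0 : 0 < K := lt_trans ltr01 K_gt1.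
have M0 : 0 < 4 * M.+1%:R ^+ 2 :> R by rewrite mulr_gt0// exprn_gt0.
have KE : 0 < K ^+ E by rewrite exprn_gt0.
exists (4 * M.+1%:R ^+ 2 * (2 * K ^+ E)); first by rewrite !mulr_gt0.
move=> t u t01 u01; have [->|tu] := eqVneq t u.
  by rewrite subrr normr0 !mulr_ge0// ?powR_ge0// ltW.
have [n [same dn dt du]] := digits_first_diff t01 u01 tu.
have L0 : 0 < cyl_length R m (digits t) n.
  by apply: (cyl_length_gt0 R m_gt1) => i; exact: digits_ge.
have Lu : cyl_length R m (digits u) n = cyl_length R m (digits t) n.
  by apply: eq_cyl_length => i ni; rewrite same.
have := point_dist t01 u01 same dn dt du.
have := hE _ _ _ t01 u01 same.
have := hE _ _ _ u01 t01 (fun i ni => esym (same i ni)); rewrite Lu distrC.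
set L := cyl_length R m (digits t) n in L0 *.
set St := (\sum_(i < n.+2) digits t i).+1; set Su := (\sum_(i < n.+2) digits u i).+1.
set X := `|point t - point u|; set T := `|t - u| => hu ht hL.
have T0 : 0 <= T by exact: normr_ge0.
have X0 : 0 <= X by exact: normr_ge0.
have k1 : 1 <= K ^+ cube_root n by rewrite exprn_ege1// ltW.
have drop S : T * S%:R * K ^+ cube_root n <= K ^+ E * L `^ s ->
    T * S%:R <= K ^+ E * L `^ s.
  by move=> h; apply: le_trans h; rewrite ler_peMr// mulr_ge0.
have {drop hu ht} TS : T * (St + Su)%:R <= 2 * K ^+ E * L `^ s.
  have := drop _ hu; have := drop _ ht; rewrite natrD; lra.
have D0 : 0 < (St + Su)%:R :> R by rewrite ltr0n.
set A := 4 * M.+1%:R ^+ 2 * (St + Su)%:R in hL.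
have A1 : 1 <= A.
  rewrite /A -[leLHS]mulr1 ler_pM// ?ler1n//.
  have : 1 <= M.+1%:R ^+ 2 :> R by rewrite exprn_ege1// ler1n.
  lra.
have /andP[s0 s1] := s_itv.
have LA : L `^ s <= A * X `^ s.
  apply: (@le_trans _ _ ((A * X) `^ s)).
    by apply: ge0_ler_powR => //; rewrite nnegrE ?mulr_ge0//; lra.
  rewrite powRM//; last by lra.
  by rewrite ler_wpM2r ?powR_ge0// ler1_powR//; lra.
rewrite -(ler_pM2r D0); apply: le_trans TS _.
have -> : 4 * M.+1%:R ^+ 2 * (2 * K ^+ E) * X `^ s * (St + Su)%:R =
  2 * K ^+ E * (A * X `^ s) by rewrite /A; ring.
by rewrite ler_wpM2l// mulr_ge0// ltW.
Qed.

Hypothesis loglog_slow : forall k, (k0 <= k)%N ->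
  loglog R (k.+1 ^ 3) - loglog R (k ^ 3) <= 1 /\
  alpha * (loglog R (k.+1 ^ 3) - loglog R (k ^ 3)) <= alpha ^+ 2.

Lemma point_in_E_set t : 0 <= t < 1 -> irrational (point t) ->
  E_set theta alpha (point t).
Proof.
move=> t01 irr; have ma := fun i => digits_ge i t01.
have digitE k := digit_tail theta_gt0 m_gt1 theta_sq k ma.
split => //.
- by have /andP[a b] := tail_bounds theta_gt0 m_gt1 theta_sq 0 ma; rewrite !ltW.
- by case=> // n _; rewrite digitE ltry.
rewrite (eq_cvg _ _ (trimmed_ratioE digitE)).
exact: (follows_ratio_cvg alpha_ge0 m_gt1 m_leM k0_gt1 k0_large loglog_slow
  (digits_follow t01)).
Qed.

Lemma E_set_measure_neq0 : hausdorff_measure s (E_set theta alpha) <> 0%E.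
Proof.
have [C C0 hC] := point_hoelder.
pose N : set R := [set t | 0 <= t < 1 /\ rational (point t)].
have cN : countable N.
  have inj : {in N &, injective point}.
    by move=> t u; rewrite !inE => -[t01 _] [u01 _]; exact: point_inj.
  rewrite -(eq_countable (inj_card_eq inj)).
  apply: sub_countable (countable_rational R); apply: subset_card_le.
  by move=> _ [t [_ rt] <-].
have /andP[s0 _] := s_itv.
apply: (hausdorff_measure_neq0 s0 C0 cN _ hC) => t t01 Nt.
by apply: point_in_E_set => // rt; apply: Nt.
Qed.

End HoelderCoding.

Theorem theorem1p1 (R : realType) (theta : R) (m : nat)
    (theta_itv : 0 < theta < 1) (theta_irr : irrational theta)
    (m_gt0 : (0 < m)%N) (m_nonsquare : ~ exists k : nat, m = (k ^ 2)%N)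
    (theta_sq : theta ^+ 2 = 1 / m%:R)
    (alpha : R) (alpha_ge0 : 0 <= alpha) :
  hausdorff_dim (E_set theta alpha) = 1%E.
Proof.
have /andP[theta_gt0 theta_lt1] := theta_itv.
have m_gt1 : (1 < m)%N.
  by case: m m_gt0 m_nonsquare {theta_sq} => [|[|]]// _ []; exists 1%N.
have theta_sq' : theta ^+ 2 * m%:R = 1.
  by rewrite theta_sq div1r mulVf// pnatr_eq0 -lt0n.
apply: hausdorff_dim_eq1.
  by move=> x [/andP[x0 x1] _ _ _]; rewrite /= in_itv /= x0 (le_trans x1)// ltW.
move=> s /[dup] s_itv /andP[_ s1].
have [M [K [mM K1 slack]]] := free_mass_slack m_gt1 s1.
have [k0 [k0_gt1 k0_large slow]] := loglog_cube_start alpha_ge0.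
exact: (E_set_measure_neq0 theta_gt0 m_gt1 theta_sq' alpha_ge0 s_itv K1 mM k0_gt1
  k0_large slack slow).
Qed.
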